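(* Let $\varphi$ be an endomorphism of a subshift $(X,\sigma)$. (1) If $\varphi$ is positively left $\sigma$-expansive, then $\varphi$ is essentially weakly $q$-R; if $\varphi$ is positively right $\sigma$-expansive, then $\varphi$ is essentially weakly $q$-L. (2) When $\varphi$ is onto, $\varphi$ is essentially weakly $q$-R and left $\sigma$-expansive if and only if $\varphi$ is positively left $\sigma$-expansive; and $\varphi$ is essentially weakly $q$-L and right $\sigma$-expansive if and only if $\varphi$ is positively right $\sigma$-expansive. (3) If $(X,\sigma)$ is an SFT and $\varphi$ is one-to-one or $\sigma$ is topologically transitive, then (2) holds with every ''weakly'' deleted.
   Context: **Subshifts.** An alphabet is a finite set with at least two elements. For an alphabet $A$, $A^{\mathbb Z}$ carries the product topology; the shift maps $(a_j)_j$ to $(a_{j+1})_j$. A subshift $(X,\sigma)$ over $A$ is a closed $X\subset A^{\mathbb Z}$ with $\sigma(X)=X$, $\sigma$ being the restricted shift; $d_X$ is a compatible metric. An endomorphism of $(X,\sigma)$ is a continuous map $\varphi:X\to X$ commuting with $\sigma$ (not assumed onto). **Graphs.** A graph is a finite directed graph $G$ (multiple arcs, loops allowed) with arc-set $A_G$, vertex-set $V_G$ and initial/terminal vertex maps $i_G,t_G:A_G\to V_G$; it is nondegenerate if $i_G,t_G$ are onto. $X_G\subset A_G^{\mathbb Z}$ is the set of bi-infinite paths ($t_G(a_j)=i_G(a_{j+1})$ for all $j$) and $\sigma_G$ its shift; for $G$ nondegenerate, $(X_G,\sigma_G)$ is called a topological Markov shift. An SFT is a subshift topologically conjugate to a topological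 Markov shift. A graph-homomorphism $h=(h_A,h_V):\Gamma\to G$ is a pair of maps on arcs and vertices compatible with $i,t$; it induces $\phi_h:X_\Gamma\to X_G$, $(\alpha_j)\mapsto(h_A(\alpha_j))$. $h$ is weakly left-resolving (resp. weakly right-resolving) if every arc $\alpha$ of $\Gamma$ is uniquely determined by $t_\Gamma(\alpha)$ (resp. $i_\Gamma(\alpha)$) and $h_A(\alpha)$; it is left-resolving (resp. right-resolving) if for every $u\in V_\Gamma$, $a\in A_G$ with $t_G(a)=h_V(u)$ (resp. $i_G(a)=h_V(u)$) there is a unique $\alpha\in A_\Gamma$ with $h_A(\alpha)=a$ and $t_\Gamma(\alpha)=u$ (resp. $i_\Gamma(\alpha)=u$). **Resolving endomorphisms.** A textile system $T=(p,q:\Gamma\to G)$ is a pair of graph-homomorphisms $p,q:\Gamma\to G$. $T$ is (weakly) $q$-L if $q$ is (weakly) left-resolving, (weakly) $q$-R if $q$ is (weakly) right-resolving. For each of these terms $\mathcal P$: an endomorphism $\varphi$ of a subshift $(X,\sigma)$ is weakly $\mathcal P$ if there are a weakly $\mathcal P$ textile system $T=(p,q:\Gamma\to G)$ and a closed shift-invariant $Z\subset X_\Gamma$ such that $\phi_p|_Z$ is injective, $\phi_p(Z)=X$, $\phi_q(Z)\subset X$ and $\varphi=\phi_q\circ(\phi_p|_Z)^{-1}$. An onto endomorphism $\varphi$ of a topological Markov shift $(X_G,\sigma_G)$ is $\mathcal P$ if there is a $\mathcal P$ textile system $T=(p,q:\Gamma\to G)$ such that, with $Z_T$ the set of $z\in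 X_\Gamma$ for which there is $(z_i)_{i\in\mathbb Z}$ in $X_\Gamma$ with $z_0=z$ and $\phi_q(z_{i-1})=\phi_p(z_i)$ for all $i$, one has $\phi_p(Z_T)=X_G$, $\phi_p|_{Z_T}$ is injective and $\varphi=\phi_q\circ(\phi_p|_{Z_T})^{-1}$. An endomorphism $\varphi$ of $(X,\sigma)$ is essentially weakly $\mathcal P$ (resp. an onto endomorphism of an SFT is essentially $\mathcal P$) if there are a subshift (resp. topological Markov shift) $(X',\sigma')$, a weakly $\mathcal P$ (resp. $\mathcal P$) endomorphism $\varphi'$ of it and a homeomorphism $\theta:X\to X'$ with $\theta\sigma=\sigma'\theta$, $\theta\varphi=\varphi'\theta$. **Expansiveness.** A $\varphi$-orbit is a sequence $(x_i)_{i\in\mathbb Z}$ with $\varphi(x_i)=x_{i+1}$. An onto endomorphism $\varphi$ is left (resp. right) $\sigma$-expansive if there is $\delta>0$ such that for any $\varphi$-orbits $(x_i),(y_i)$, $d_X(\sigma^j(x_i),\sigma^j(y_i))\le\delta$ for all $i\in\mathbb Z$ and all $j\le0$ (resp. $j\ge0$) implies $(x_i)=(y_i)$. An endomorphism $\varphi$ is positively left (resp. right) $\sigma$-expansive if there is $\delta>0$ such that for $x,y\in X$, $d_X(\sigma^j\varphi^i(x),\sigma^j\varphi^i(y))\le\delta$ for all $i\ge0$ and $j\le0$ (resp. $j\ge0$) implies $x=y$. *)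

(* Defs.v *)
From HB Require Import structures.
From mathcomp Require Import all_boot all_order all_algebra.
From mathcomp Require Import all_classical all_reals all_analysis.

Set Implicit Arguments.
Unset Strict Implicit.
Unset Printing Implicit Defensive.

Import Order.TTheory GRing.Theory Num.Theory.

Local Open Scope classical_set_scope.
Local Open Scope ring_scope.

(** * Subshifts *)

Definition fullshift (A : finType) : topologicalType :=
  {ptws int -> discrete_topology A}.

(* [shiftz j] is the [j]-th power, [j] of any sign, of the shift [shiftz 1]. *)
Definition shiftz (A : finType) (j : int) (x : fullshift A) : fullshift A :=
  fun k => x (k + j).

Definition shift (A : finType) : fullshift A -> fullshift A := shiftz 1.

(* The condition that an alphabet has at least two letters is not part of this
   record, but is imposed wherever an alphabet is introduced: the path space
   of a graph must be a subshift even if the graph has at most one arc. *)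
Record subshift (A : finType) := Subshift {
  points :> set (fullshift A);
  subshift_closed : closed points;
  subshift_invariant : @shift A @` points = points
}.

Lemma shiftz0 (A : finType) (x : fullshift A) : shiftz 0 x = x.
Proof. by apply/funext => k; rewrite /shiftz addr0. Qed.

Lemma shiftzD (A : finType) (i j : int) (x : fullshift A) :
  shiftz (i + j) x = shiftz i (shiftz j x).
Proof. by apply/funext => k; rewrite /shiftz addrA. Qed.

Lemma shiftz_subproof (A : finType) (X : subshift A) (j : int) (x : X) :
  shiftz j (val x) \in (X : set (fullshift A)).
Proof.
have shiftX y : points X y -> points X (shiftz 1 y).
  by move=> Xy; rewrite -subshift_invariant; exists y.
have unshiftX y : points X y -> points X (shiftz (-1) y).
  rewrite -{1}subshift_invariant => -[z Xz <-].
  by rewrite /shift -shiftzD addNr shiftz0.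
apply/mem_set; have Xx := set_mem (valP x); move: (val x) Xx => {}x Xx.
elim/int_rec: j => [|n IHn|n IHn].
- by rewrite shiftz0.
- by rewrite intS shiftzD; exact: shiftX.
- by rewrite intS opprD shiftzD; exact: unshiftX.
Qed.

Definition sigmaz (A : finType) (X : subshift A) (j : int) (x : X) : X :=
  exist _ (shiftz j (val x)) (shiftz_subproof j x).

Definition sigma (A : finType) (X : subshift A) : X -> X := @sigmaz A X 1.

Definition onto (S T : Type) (f : S -> T) : Prop := range f = [set: T].

Definition homeomorphism (S T : topologicalType) (f : S -> T) : Prop :=
  continuous f /\
  exists g : T -> S, [/\ continuous g, cancel f g & cancel g f].

Definition endomorphism (A : finType) (X : subshift A) (phi : X -> X) : Prop :=
  continuous phi /\ forall x, phi (sigma x) = sigma (phi x).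

Definition conjugacy (A B : finType) (X : subshift A) (Y : subshift B)
    (theta : X -> Y) : Prop :=
  homeomorphism theta /\ forall x, theta (sigma x) = sigma (theta x).

Definition topologically_transitive (A : finType) (X : subshift A) : Prop :=
  forall U V : set X, open U -> open V -> U !=set0 -> V !=set0 ->
    exists n : nat, (iter n (@sigma A X) @` U) `&` V !=set0.

(** * Graphs and topological Markov shifts *)

(* A graph is indexed by its arc-set, so that [X_G] is a set of points of the
   full shift over [A_G]. *)
Record graph (A : finType) := Graph {
  vertex : finType;
  source : A -> vertex;
  target : A -> vertex
}.

Definition nondegenerate (A : finType) (G : graph A) : Prop :=
  onto (@source A G) /\ onto (@target A G).

Definition paths (A : finType) (G : graph A) : set (fullshift A) :=
  [set x | forall j : int, target G (x j) = source G (x (j + 1))].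

Lemma paths_closed (A : finType) (G : graph A) : closed (paths G).
Proof.
have nearE (x : fullshift A) (j : int) : \forall y \near x, y j = x j.
  have pc : continuous (fun y : fullshift A => y j : discrete_topology A).
    exact: (@proj_continuous int (fun=> discrete_topology A) j).
  exact: (pc x _ (@discrete_set1 (discrete_topology A) (x j))).
move=> x clx j.
have [y [Gy [yj yj1]]] := clx _ (filterI (nearE x j) (nearE x (j + 1))).
by rewrite -yj -yj1.
Qed.

Lemma paths_invariant (A : finType) (G : graph A) :
  @shift A @` paths G = paths G.
Proof.
apply/seteqP; split => [_ [x Gx <-] j|x Gx].
  by rewrite /shift /shiftz.
exists (shiftz (-1) x); last by rewrite /shift -shiftzD subrr shiftz0.
by move=> j; rewrite /shiftz addrAC.
Qed.

Definition path_shift (A : finType) (G : graph A) : subshift A :=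
  Subshift (@paths_closed A G) (@paths_invariant A G).

Definition SFT (A : finType) (X : subshift A) : Prop :=
  exists (B : finType) (G : graph B) (theta : X -> path_shift G),
    nondegenerate G /\ conjugacy theta.

Record graph_hom (B A : finType) (Gamma : graph B) (G : graph A) := GraphHom {
  harc : B -> A;
  hvertex : vertex Gamma -> vertex G;
  hom_source : forall b, source G (harc b) = hvertex (source Gamma b);
  hom_target : forall b, target G (harc b) = hvertex (target Gamma b)
}.

Section GraphHom.
Context {B A : finType} {Gamma : graph B} {G : graph A}.
Implicit Type h : graph_hom Gamma G.

Lemma hom_map_subproof h (z : path_shift Gamma) :
  (fun j => harc h (val z j)) \in (path_shift G : set (fullshift A)).
Proof.
by apply/mem_set => j; rewrite hom_target hom_source (set_mem (valP z) j).
Qed.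

Definition hom_map h (z : path_shift Gamma) : path_shift G :=
  exist _ (fun j => harc h (val z j)) (hom_map_subproof h z).

Definition weakly_left_resolving h : Prop :=
  forall a b, target Gamma a = target Gamma b -> harc h a = harc h b -> a = b.

Definition weakly_right_resolving h : Prop :=
  forall a b, source Gamma a = source Gamma b -> harc h a = harc h b -> a = b.

Definition left_resolving h : Prop :=
  forall (u : vertex Gamma) (a : A), target G a = hvertex h u ->
    exists! b : B, harc h b = a /\ target Gamma b = u.

Definition right_resolving h : Prop :=
  forall (u : vertex Gamma) (a : A), source G a = hvertex h u ->
    exists! b : B, harc h b = a /\ source Gamma b = u.

End GraphHom.

(** * Textile systems and resolving endomorphisms *)

Record textile_system (A : finType) (G : graph A) := TextileSystem {
  tarc : finType;
  tgraph : graph tarc;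
  tp : graph_hom tgraph G;
  tq : graph_hom tgraph G
}.

Definition textile_property : Type :=
  forall (A : finType) (G : graph A), textile_system G -> Prop.

Definition weakly_qL : textile_property :=
  fun A G T => weakly_left_resolving (tq T).
Definition weakly_qR : textile_property :=
  fun A G T => weakly_right_resolving (tq T).
Definition qL : textile_property := fun A G T => left_resolving (tq T).
Definition qR : textile_property := fun A G T => right_resolving (tq T).

(* In the two definitions below [wP] is the textile property "weakly P"
   (e.g. [weakly_qL]), not "P". As [X] is a subset of [A^Z], the equality
   [phi_p (Z) = X] is read with [A_G = A]. The last clause spells out
   [phi = phi_q \o (phi_p|_Z)^-1]. *)
Definition weakly_resolving (wP : textile_property)
    (A : finType) (X : subshift A) (phi : X -> X) : Prop :=
  exists (G : graph A) (T : textile_system G)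
    (Z : set (path_shift (tgraph T))),
    [/\ wP A G T, closed Z & @sigma _ _ @` Z = Z] /\
    [/\ set_inj Z (hom_map (tp T)),
        [set val (hom_map (tp T) z) | z in Z] = X,
        [set val (hom_map (tq T) z) | z in Z] `<=` X &
        forall (x : X) z, Z z -> val (hom_map (tp T) z) = val x ->
          val (phi x) = val (hom_map (tq T) z)].

Definition essentially_weakly (wP : textile_property)
    (A : finType) (X : subshift A) (phi : X -> X) : Prop :=
  exists (B : finType) (Y : subshift B) (psi : Y -> Y) (theta : X -> Y),
    (1 < #|B|)%N /\
    [/\ endomorphism psi, weakly_resolving wP psi, conjugacy theta &
        forall x, theta (phi x) = psi (theta x)].

Definition textile_set (A : finType) (G : graph A) (T : textile_system G) :
    set (path_shift (tgraph T)) :=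
  [set z | exists zs : int -> path_shift (tgraph T), zs 0 = z /\
    forall i : int, hom_map (tq T) (zs (i - 1)) = hom_map (tp T) (zs i)].
Arguments textile_set {A G} T.

(* The last clause spells out [phi = phi_q \o (phi_p|_{Z_T})^-1]. *)
Definition resolving (P : textile_property) (A : finType) (G : graph A)
    (phi : path_shift G -> path_shift G) : Prop :=
  exists T : textile_system G,
    P A G T /\
    [/\ hom_map (tp T) @` textile_set T = [set: path_shift G],
        set_inj (textile_set T) (hom_map (tp T)) &
        forall x z, textile_set T z -> hom_map (tp T) z = x ->
          phi x = hom_map (tq T) z].

Definition essentially (P : textile_property)
    (A : finType) (X : subshift A) (phi : X -> X) : Prop :=
  exists (B : finType) (G : graph B)
    (psi : path_shift G -> path_shift G) (theta : X -> path_shift G),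
    nondegenerate G /\
    [/\ endomorphism psi, onto psi, resolving P psi, conjugacy theta &
        forall x, theta (phi x) = psi (theta x)].

(** * Expansiveness *)

Record compatible_metric (R : realType) (T : topologicalType) (d : T -> T -> R)
    : Prop := CompatibleMetric {
  distxx : forall x, d x x = 0;
  dist_positivity : forall x y, d x y = 0 -> x = y;
  dist_sym : forall x y, d x y = d y x;
  dist_triangle : forall y x z, d x z <= d x y + d y z;
  dist_nbhsE : forall x : T,
    nbhs x = filter_from [set e : R | 0 < e] (fun e => [set y | d x y < e])
}.

Section Expansive.
Context {R : realType} {A : finType} {X : subshift A}.
Implicit Types (d : X -> X -> R) (phi : X -> X).

Definition is_orbit phi (x : int -> X) : Prop :=
  forall i : int, phi (x i) = x (i + 1).

Definition left_expansive d phi : Prop :=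
  exists2 delta : R, 0 < delta &
    forall x y : int -> X, is_orbit phi x -> is_orbit phi y ->
      (forall i j : int, j <= 0 ->
         d (sigmaz j (x i)) (sigmaz j (y i)) <= delta) ->
      x = y.

Definition right_expansive d phi : Prop :=
  exists2 delta : R, 0 < delta &
    forall x y : int -> X, is_orbit phi x -> is_orbit phi y ->
      (forall i j : int, 0 <= j ->
         d (sigmaz j (x i)) (sigmaz j (y i)) <= delta) ->
      x = y.

Definition positively_left_expansive d phi : Prop :=
  exists2 delta : R, 0 < delta &
    forall x y : X,
      (forall (i : nat) (j : int), j <= 0 ->
         d (sigmaz j (iter i phi x)) (sigmaz j (iter i phi y)) <= delta) ->
      x = y.

Definition positively_right_expansive d phi : Prop :=
  exists2 delta : R, 0 < delta &
    forall x y : X,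
      (forall (i : nat) (j : int), 0 <= j ->
         d (sigmaz j (iter i phi x)) (sigmaz j (iter i phi y)) <= delta) ->
      x = y.

End Expansive.

(* Main.v *)
Require Import Defs.
From mathcomp Require Import all_boot all_order all_algebra.
From mathcomp Require Import all_classical all_reals all_analysis.
From mathcomp Require Import zify lra.

(** Each claim has two mirror-image halves. They are proved together for an
    orientation [e]: [true] for the half about [q]-R and left expansiveness,
    [false] for the half about [q]-L and right expansiveness. Points are read
    through [letter e], which reverses the indices when [e] is [false], and
    [src e], [tgt e] exchange the two ends of every arc accordingly; in these
    coordinates the two halves have the same text, which is that of the first.
    An orbit [(x_i)] is pictured as an array with rows [i] and columns [k].

    By compactness, expansiveness loses its metric ([pos_expansive_metric],
    [orbit_expansive_metric]) and becomes finite: positive expansiveness means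
    that for some [n] the letter [x_k] is a function of the letters
    [(phi^i x)_(k-j)] with [0 <= i <= n] and [1 <= j <= n]
    ([pos_expansive_local]).

    Part (1). Let the arcs of [Gamma] be the patterns with [n + 2] rows
    [x, phi x, ..., phi^(n+1) x] and [n + 1] columns that occur in the arrays
    of [phi]. The source of an arc consists of its first [n] columns and its
    target of its last [n]; [p] forgets the last row and [q] the first. The
    source and the [q]-image of an arc show all its letters except the top one
    of the last column, and that letter is determined by the columns before it:
    [q] is weakly right-resolving.

    Part (2). Positive expansiveness trivially gives expansiveness. Conversely
    let the arrays of two orbits agree on [i >= 0, k <= 0]. By expansiveness
    and compactness they agree in column [1] too, from some row [N] on. If they
    agree in column [1] on row [i + 1], they do so on row [i], since a weakly
    [q]-R textile system reads [x_i] from left to right off [phi x_i]. So they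
    agree in column [1] on all rows [i >= 0], and by induction in all columns
    ([weakly_resolving_pos_expansive]).

    Part (3). Conjugate [X] to a path shift. With the patterns of part (1), made
    wide enough, [p] and [q] become homomorphisms between pattern graphs with
    [n + 2] and [n + 1] rows whose path shifts are copies of [X]; then [p] is a
    conjugacy, its inverse followed by [q] is a copy of [phi], and [q] is weakly
    right-resolving. It remains to lift through [q] every arc of the smaller
    graph at every vertex over its source.
    If [phi] is invertible, splice [phi x] on the left with the point [y] that
    shows the arc on the right: the preimage of the spliced point shows the
    lift ([injective_pattern_covering]).
    If [sigma] is transitive, suppose that the arc [a] has no lift at the
    vertex [u], and consider the vertices at which the lifts of a given path
    end. From any one of these, [Gamma] leads to [u]; extending the path
    accordingly and then by [a] destroys one of them, and no new one appears
    because [q] is weakly right-resolving. Repeating this produces a path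
    without lifts, although [q] is onto ([onto_covering]). *)

Set Implicit Arguments.
Unset Strict Implicit.
Unset Printing Implicit Defensive.

Import Order.TTheory GRing.Theory Num.Theory.

Local Open Scope classical_set_scope.
Local Open Scope ring_scope.

(** * Locally constant maps and compactness *)

Definition locally_constant (T : topologicalType) (C : Type) (f : T -> C) :=
  forall x, \forall y \near x, f y = f x.

Lemma locally_constant_comp (S T : topologicalType) (C : Type) (f : T -> C)
    (g : S -> T) :
  continuous g -> locally_constant f -> locally_constant (f \o g).
Proof. by move=> cg lf x; exact: (cg x _ (lf (g x))). Qed.

Lemma locally_constant_eq (T : topologicalType) (C D : Type) (f : T -> C)
    (g : T -> D) :
  (forall x y, f x = f y -> g x = g y) ->
  locally_constant f -> locally_constant g.
Proof. by move=> fg lf x; apply: filterS (lf x) => y /fg. Qed.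

Lemma locally_constant_finfun (T : topologicalType) (I : finType) (C : Type)
    (f : T -> {ffun I -> C}) :
  (forall i, locally_constant (f^~ i)) -> locally_constant f.
Proof.
move=> lf x; have := @filter_forall T I (fun i y => f y i = f x i) (nbhs x) (nbhs_filter x).
by move=> /(_ (fun i => lf i x)); apply: filterS => y fE; exact/ffunP.
Qed.

Lemma locally_constant_open (T : topologicalType) (C : Type) (f : T -> C) c :
  locally_constant f -> open [set x | f x = c].
Proof. by move=> lf; rewrite openE => x /= <-; exact: lf. Qed.

Lemma locally_constant_coord (A : finType) (k : int) :
  locally_constant (fun x : fullshift A => x k).
Proof.
move=> x; have pc : continuous (fun y : fullshift A => y k : discrete_topology A).
  exact: (@proj_continuous int (fun=> discrete_topology A) k).
exact: (pc x _ (@discrete_set1 (discrete_topology A) (x k))).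
Qed.

Lemma val_continuous (A : finType) (X : subshift A) :
  continuous (val : X -> fullshift A).
Proof. exact: initial_continuous. Qed.

Lemma locally_constant_val (A : finType) (X : subshift A) (k : int) :
  locally_constant (fun x : X => val x k).
Proof.
exact: (locally_constant_comp (@val_continuous A X) (locally_constant_coord k)).
Qed.

Lemma coordwise_continuous (T : topologicalType) (A : finType)
    (f : T -> fullshift A) :
  (forall k, locally_constant (fun t => f t k)) -> continuous f.
Proof.
move=> lf x; apply/cvg_sup => k U [V] [[W oW <-] WfN WU].
suff: nbhs x (f @^-1` U) by [].
by apply: filterS (lf k x) => y /= fE; apply: WU; rewrite /= fE.
Qed.

Lemma subshift_continuous (T : topologicalType) (A : finType) (X : subshift A)
    (f : T -> X) :
  (forall k, locally_constant (fun t => val (f t) k)) -> continuous f.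
Proof.
move=> /coordwise_continuous cf x U [V] [[W oW <-] WfN WU].
have /cf fW : nbhs (val (f x)) W by apply: open_nbhs_nbhs.
suff: nbhs x (f @^-1` U) by [].
have : nbhs x ((val \o f) @^-1` W) by [].
by apply: filterS => y Wy; apply: WU.
Qed.

Lemma fullshift_compact (A : finType) : compact [set: fullshift A].
Proof.
suff : compact [set x : fullshift A | forall i, [set: discrete_topology A] (x i)].
  by congr compact; apply/seteqP; split.
apply: (@tychonoff int (fun=> discrete_topology A) (fun=> setT)) => _.
apply: finite_compact; exact: finite_finset.
Qed.

Lemma subshift_compact (A : finType) (X : subshift A) : compact [set: X].
Proof.
have cX : compact (X : set (fullshift A)).
  apply: subclosed_compact (@fullshift_compact A) _ => //.
  exact: subshift_closed.
move: cX; rewrite !compact_near_coveringP => cX I F P FF PF.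
have cX' := (near_covering_withinP _).2 cX.
pose Q i (x : fullshift A) := forall h : x \in (X : set _), P i (exist _ x h).
have QF x : (X : set _) x -> \forall x' \near x & i \near F, (X : set _) x' -> Q i x'.
  move=> Xx; have := PF (exist _ x (mem_set Xx)) Logic.I.
  case=> -[U V] /= [[U' [[W oW <-] /= Wx WU]] FV] UV.
  exists (W, V); first by split => //; apply: open_nbhs_nbhs.
  by move=> [y i] [/= Wy Vi] _ h; apply: (UV (_, _)); split => //; exact: WU.
have := cX' I F Q FF QF.
by apply: filterS => i + [x h] _; apply; exact: set_mem.
Qed.

Lemma fullshift_hausdorff (A : finType) : hausdorff_space (fullshift A).
Proof.
move=> x y xy; apply/funext => k.
have [z [zx zy]] := xy _ _ (locally_constant_coord k x) (locally_constant_coord k y).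
by rewrite -zx.
Qed.

Lemma subshift_hausdorff (A : finType) (X : subshift A) : hausdorff_space X.
Proof.
move=> x y xy; apply/val_inj/funext => k.
have [z [zx zy]] := xy _ _ (locally_constant_val k x) (locally_constant_val k y).
by rewrite -zx.
Qed.

(** All the finiteness in the proof comes from here: a quantity determined by
    infinitely many locally constant observations is determined by finitely
    many. On the compact square of [K], each pair is either not separated by
    [g] or separated by some [f j], and both persist nearby. The function
    [size] exhausts the observations by finitely indexed stages. *)
Lemma finite_determination (T : topologicalType) (K : set T) (J C D : Type)
    (size : J -> nat) (f : J -> T -> C) (g : T -> D) :
  compact K -> (forall j, locally_constant (f j)) -> locally_constant g ->
  (forall x y, K x -> K y -> (forall j, f j x = f j y) -> g x = g y) ->
  exists n, forall x y, K x -> K y ->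
    (forall j, (size j <= n)%N -> f j x = f j y) -> g x = g y.
Proof.
move=> cK lf lg fg; have := compact_setX cK cK.
rewrite compact_near_coveringP => /(_ nat \oo (fun n (p : T * T) =>
  (forall j, (size j <= n)%N -> f j p.1 = f j p.2) -> g p.1 = g p.2) _).
case; last first.
  move=> n _ /(_ n (leqnn n)) Kn; exists n => x y Kx Ky.
  exact: (Kn (x, y)).
move=> -[x y] [/= Kx Ky].
have [gE|gN] := pselect (g x = g y).
  exists ([set p | g p.1 = g x /\ g p.2 = g y], setT).
    split; last exact: filterT.
    by exists ([set x' | g x' = g x], [set y' | g y' = g y]); [split; apply: lg|].
  by move=> [[x' y'] n] [[/= -> -> _ _]].
have [j fN] : exists j, f j x <> f j y.
  by apply: contrapT => /forallNP fE; apply/gN/fg => // j; exact: contrapT.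
exists ([set p | f j p.1 = f j x /\ f j p.2 = f j y], [set n | (size j <= n)%N]).
  split; last exact: nbhs_infty_ge.
  exists ([set x' | f j x' = f j x], [set y' | f j y' = f j y]) => //.
  by split; apply: lf.
by move=> [[x' y'] n] [[/= fx fy] jn] /(_ j jn); rewrite /= fx fy.
Qed.

(** * Oriented letters and expansiveness *)

Definition dir (e : bool) : int := if e then 1 else -1.

Lemma dirK (e : bool) (k : int) : dir e * (dir e * k) = k.
Proof. by case: e => /=; lia. Qed.

Lemma sigmaz0 (A : finType) (X : subshift A) (x : X) : sigmaz 0 x = x.
Proof. by apply/val_inj; exact: shiftz0. Qed.

Lemma sigmazD (A : finType) (X : subshift A) (i j : int) (x : X) :
  sigmaz (i + j) x = sigmaz i (sigmaz j x).
Proof. by apply/val_inj; exact: shiftzD. Qed.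

Definition letter (e : bool) (A : finType) (X : subshift A) (x : X) (k : int) : A :=
  val x (dir e * k).

Definition dshift (e : bool) (A : finType) (X : subshift A) (j : int) (x : X) : X :=
  sigmaz (dir e * j) x.

Lemma letter_dshift e (A : finType) (X : subshift A) (x : X) j k :
  letter e (dshift e j x) k = letter e x (k + j).
Proof. by rewrite /letter /dshift /= /shiftz mulrDr. Qed.

Lemma letterP e (A : finType) (X : subshift A) (x y : X) :
  (forall k, letter e x k = letter e y k) -> x = y.
Proof.
move=> xy; apply/val_inj/funext => k.
by have := xy (dir e * k); rewrite /letter dirK.
Qed.

Lemma dshift0 e (A : finType) (X : subshift A) (x : X) : dshift e 0 x = x.
Proof. by rewrite /dshift mulr0 sigmaz0. Qed.

Lemma dshiftD e (A : finType) (X : subshift A) (i j : int) (x : X) :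
  dshift e (i + j) x = dshift e i (dshift e j x).
Proof. by rewrite /dshift mulrDr sigmazD. Qed.

Lemma dshift_inj e (A : finType) (X : subshift A) j :
  injective (@dshift e A X j).
Proof.
move=> x y /(congr1 (dshift e (- j))).
by rewrite -!dshiftD addNr !dshift0.
Qed.

Lemma locally_constant_letter e (A : finType) (X : subshift A) k :
  locally_constant (fun x : X => letter e x k).
Proof. exact: locally_constant_val. Qed.

Lemma sigmaz_continuous (A : finType) (X : subshift A) j :
  continuous (@sigmaz A X j).
Proof. by apply: subshift_continuous => k; exact: locally_constant_val. Qed.

Section Equivariant.
Context {A B : finType} {X : subshift A} {Y : subshift B}.

Definition equivariant (f : X -> Y) := forall x, f (sigma x) = sigma (f x).

Lemma equivariant_sigmaz (f : X -> Y) j x :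
  equivariant f -> f (sigmaz j x) = sigmaz j (f x).
Proof.
move=> fS; elim/int_rec: j x => [|n IHn|n IHn] x.
- by rewrite !sigmaz0.
- by rewrite intS !sigmazD -IHn -[sigmaz 1 (f _)]fS.
- rewrite intS opprD !sigmazD -IHn.
  move: (sigmaz (- n%:Z) x) => z; apply: (@dshift_inj true _ _ 1).
  rewrite /dshift (_ : dir true * 1 = 1) //.
  by rewrite -[LHS]fS /sigma -!sigmazD subrr !sigmaz0.
Qed.

Lemma equivariant_dshift e (f : X -> Y) j x :
  equivariant f -> f (dshift e j x) = dshift e j (f x).
Proof. exact: equivariant_sigmaz. Qed.

End Equivariant.

Lemma equivariant_iter (A : finType) (X : subshift A) (f : X -> X) i :
  equivariant f -> equivariant (iter i f).
Proof. by move=> fS x; elim: i => //= i ->; exact: fS. Qed.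

Lemma iter_dshift e (A : finType) (X : subshift A) (f : X -> X) i j x :
  equivariant f -> iter i f (dshift e j x) = dshift e j (iter i f x).
Proof. by move=> fS; apply/equivariant_dshift/equivariant_iter. Qed.

Lemma iter_continuous (T : topologicalType) (f : T -> T) i :
  continuous f -> continuous (iter i f).
Proof.
move=> cf; elim: i => [|i IHi] x; first exact: cvg_id.
by apply: (@continuous_comp _ _ _ (iter i f) f); [exact: IHi|exact: cf].
Qed.

Lemma near_window (A : finType) (X : subshift A) (x : X) (k : int) (m : nat) :
  \forall y \near x, forall j : int, `|j| <= m%:Z -> val y (k + j) = val x (k + j).
Proof.
pose w (y : X) : {ffun 'I_(m.*2.+1) -> A} :=
  [ffun j : 'I_(m.*2.+1) => val y (k + (j%:Z - m%:Z))].
have lw : locally_constant w.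
  apply: locally_constant_finfun => j z.
  apply: filterS (locally_constant_val (k + (j%:Z - m%:Z)) z) => y.
  by rewrite !ffunE.
apply: filterS (lw x) => y wE j jm; have jlt : (absz (j + m%:Z)%R < m.*2.+1)%N by lia.
have := congr1 (fun u : {ffun _ -> A} => u (Ordinal jlt)) wE.
by rewrite !ffunE /=; have -> : (absz (j + m%:Z))%:Z - m%:Z = j by lia.
Qed.

(** The Curtis-Hedlund-Lyndon theorem, in a form that also covers inverses: a
    map [g] that factors through [f] on a compact invariant set, even if the
    factoring map is not given, is computed from [f] by a window of finite
    width. *)
Lemma factor_local e (A B C : finType) (X : subshift A) (Y : subshift B)
    (W : subshift C) (K : set X) (f : X -> Y) (g : X -> W) :
  compact K -> (forall j x, K x -> K (dshift e j x)) ->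
  continuous f -> equivariant f -> continuous g -> equivariant g ->
  (forall x y, K x -> K y -> f x = f y -> g x = g y) ->
  exists m : nat, forall x y k, K x -> K y ->
    (forall j : int, `|j| <= m%:Z -> letter e (f x) (k + j) = letter e (f y) (k + j)) ->
    letter e (g x) k = letter e (g y) k.
Proof.
move=> cK KS cf fS cg gS fg.
have [||x y Kx Ky fE|m mP] := @finite_determination X K int B C absz
  (fun j x => letter e (f x) j) (fun x => letter e (g x) 0) cK.
- by move=> j; exact: (locally_constant_comp cf (@locally_constant_letter e _ Y j)).
- exact: (locally_constant_comp cg (@locally_constant_letter e _ W 0)).
- by rewrite (fg x y) //; exact: (@letterP e).
exists m => x y k Kx Ky fE.
have := mP (dshift e k x) (dshift e k y) (KS _ _ Kx) (KS _ _ Ky).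
rewrite !(equivariant_dshift e k _ gS) !letter_dshift !add0r; apply=> j jm.
by rewrite !(equivariant_dshift e k _ fS) !letter_dshift addrC fE //; lia.
Qed.

Lemma endomorphism_local e (A B : finType) (X : subshift A) (Y : subshift B)
    (f : X -> Y) :
  continuous f -> equivariant f ->
  exists m : nat, forall x y k,
    (forall j : int, `|j| <= m%:Z -> letter e x (k + j) = letter e y (k + j)) ->
    letter e (f x) k = letter e (f y) k.
Proof.
move=> cf fS; have cid : continuous (id : X -> X) by move=> x; exact: cvg_id.
have [|m mP] := @factor_local e _ _ _ X X Y setT id f
  (@subshift_compact _ X) (fun _ _ _ => Logic.I) cid (fun _ => erefl) cf fS.
  by move=> x y _ _ ->.
by exists m => x y k; exact: mP.
Qed.

Lemma injective_local e (A B : finType) (X : subshift A) (Y : subshift B)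
    (f : X -> Y) :
  continuous f -> equivariant f -> injective f ->
  exists m : nat, forall x y k,
    (forall j : int, `|j| <= m%:Z -> letter e (f x) (k + j) = letter e (f y) (k + j)) ->
    letter e x k = letter e y k.
Proof.
move=> cf fS fI; have cid : continuous (id : X -> X) by move=> x; exact: cvg_id.
have [|m mP] := @factor_local e _ _ _ X Y X setT f id
  (@subshift_compact _ X) (fun _ _ _ => Logic.I) cf fS cid (fun _ => erefl).
  by move=> x y _ _ /fI.
by exists m => x y k; exact: mP.
Qed.

(** The inverse is continuous because, by [injective_local], it has a finite
    window. *)
Lemma bijective_conjugacy (A B : finType) (X : subshift A) (Y : subshift B)
    (f : X -> Y) :
  continuous f -> equivariant f -> injective f -> (forall y, exists x, f x = y) ->
  conjugacy f.
Proof.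
move=> cf fS fI fO; split=> //; split=> //.
have [g gK] : exists g, cancel g f.
  by exists (fun y => sval (cid (fO y))) => y; case: cid.
exists g; split => //; last by move=> x; apply: fI; rewrite gK.
have [m mP] := injective_local true cf fS fI.
apply: subshift_continuous => k y.
apply: filterS (near_window y k m) => y' yE.
have := mP (g y') (g y) k; rewrite !gK /letter /= !mul1r; apply=> j jm.
by rewrite !mul1r yE.
Qed.

(** Positive left ([e = true]) or right ([e = false]) expansiveness with the
    condition on distances replaced by agreement on a half-line. *)
Definition pos_expansive e (A : finType) (X : subshift A) (phi : X -> X) :=
  forall x y : X,
    (forall (i : nat) (k : int), k <= 0 ->
       letter e (iter i phi x) k = letter e (iter i phi y) k) -> x = y.

Definition determination_bound e (A : finType) (X : subshift A) (phi : X -> X) n :=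
  forall (x y : X) (k : int),
    (forall i j : nat, (i <= n)%N -> (j < n)%N ->
      letter e (iter i phi x) (k - 1 - j%:Z) = letter e (iter i phi y) (k - 1 - j%:Z)) ->
    letter e x k = letter e y k.

Definition orbit_expansive e (A : finType) (X : subshift A) (phi : X -> X) :=
  forall x y : int -> X, is_orbit phi x -> is_orbit phi y ->
    (forall i k : int, k <= 0 -> letter e (x i) k = letter e (y i) k) -> x = y.

Lemma orbit_iter (A : finType) (X : subshift A) (phi : X -> X) (x : int -> X) (i : int) n :
  is_orbit phi x -> iter n phi (x i) = x (i + n%:Z).
Proof.
by move=> ox; elim: n => [|n IHn]; rewrite ?addr0 //= IHn ox intS addrAC addrA.
Qed.

Lemma pos_expansive_orbit e (A : finType) (X : subshift A) (phi : X -> X) :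
  pos_expansive e phi -> orbit_expansive e phi.
Proof.
move=> pe x y ox oy xy; apply/funext => i; apply: pe => n k k0.
by rewrite !orbit_iter // xy.
Qed.

Section Metric.
Context {R : realType} {A : finType} {X : subshift A} {d : X -> X -> R}.
Hypothesis hd : compatible_metric d.

Lemma metric_separates (C : Type) (g : X -> C) :
  locally_constant g ->
  exists2 delta : R, 0 < delta & forall x y, d x y <= delta -> g x = g y.
Proof.
move=> lg; have /compact_near_coveringP := @subshift_compact _ X.
move=> /(_ R (0^'+) (fun delta x => forall y, d x y <= delta -> g x = g y) _) H.
have /H : forall x : X, setT x -> \forall x' \near x & delta \near (0:R)^'+,
    forall y, d x' y <= delta -> g x' = g y.
  move=> x _; have : nbhs x [set y | g y = g x] := lg x.
  rewrite {1}(dist_nbhsE hd) => -[eps /= eps0 gE].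
  exists ([set x' | d x x' < eps / 2], [set delta | delta < eps / 2]).
    split=> /=; last by apply: nbhs_right_lt; lra.
    by rewrite {1}(dist_nbhsE hd); exists (eps / 2) => //=; lra.
  move=> [x' delta] [/= xx' dl] y xy.
  have e1 := gE x'; have e2 := gE y; rewrite /= in e1 e2.
  rewrite e1 ?e2 //; last by lra.
  by have := dist_triangle hd x' x y; lra.
move=> near_sep.
have [delta [dP d0]] : exists delta : R,
    (setT `<=` (fun x => forall y, d x y <= delta -> g x = g y)) /\ 0 < delta.
  apply: (@filter_ex _ ((0:R)^'+)); apply: filterI near_sep _.
  exact: nbhs_right_gt.
by exists delta => // x y; exact: dP.
Qed.

Lemma nbhs_cylinder (x : X) (U : set X) :
  nbhs x U -> exists N : nat, forall y : X,
    (forall k : int, `|k| <= N%:Z -> val y k = val x k) -> U y.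
Proof.
move=> xU; have /compact_near_coveringP := @subshift_compact _ X.
move=> /(_ nat \oo (fun N y =>
  (forall k : int, `|k| <= N%:Z -> val y k = val x k) -> U y) _) H.
case: H; last by move=> N _ /(_ N (leqnn N)) NP; exists N => y; exact: NP.
move=> y _; have [->|yx] := pselect (y = x).
  by exists (U, setT); [split => //; exact: filterT|move=> [y' N] []].
have [k kP] : exists k, val y k <> val x k.
  apply: contrapT => /forallNP yxE; apply/yx/val_inj/funext => k.
  by apply: contrapT; exact: (yxE k).
exists ([set y' : X | val y' k = val y k], [set N | (absz k <= N)%N]).
  split; [exact: (locally_constant_val k y)|exact: nbhs_infty_ge].
move=> [y' N] [/= yk kN] /(_ k); rewrite yk => abs.
by exfalso; apply/kP/abs; lia.
Qed.

Lemma cylinder_small (delta : R) : 0 < delta ->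
  exists N : nat, forall x y : X,
    (forall k : int, `|k| <= N%:Z -> val x k = val y k) -> d x y <= delta.
Proof.
move=> d0; have /compact_near_coveringP := @subshift_compact _ X.
move=> /(_ nat \oo (fun N x => forall y : X,
  (forall k : int, `|k| <= N%:Z -> val x k = val y k) -> d x y <= delta) _) H.
case: H; last by move=> N _ /(_ N (leqnn N)) NP; exists N => x y; exact: NP.
move=> x _.
have bx : nbhs x [set y | d x y < delta / 2].
  by rewrite {1}(dist_nbhsE hd); exists (delta / 2) => //=; lra.
have [M MP] := nbhs_cylinder bx.
exists ([set x' : X | forall j : int, `|j| <= M%:Z -> val x' (0 + j) = val x (0 + j)],
   [set N | (M <= N)%N]).
  by split; [exact: near_window|exact: nbhs_infty_ge].
move=> [x' N] [/= x'x MN] y x'y.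
have x'M k : `|k| <= M%:Z -> val x' k = val x k.
  by move=> kM; have := x'x k kM; rewrite add0r.
have := MP _ x'M; have /= := MP y.
have yM k : `|k| <= M%:Z -> val y k = val x k.
  by move=> kM; apply: etrans (esym (x'y k _)) (x'M k kM); lia.
move=> /(_ yM) xy xx'; have := dist_triangle hd x x' y.
by rewrite (dist_sym hd x' x) /=; move: xy xx'; rewrite /=; lra.
Qed.

(** Agreement on a half-line bounds the distances of all shifts along a
    possibly shorter half-line; the loss [N] is harmless as expansiveness is
    insensitive to shifting both points. *)
Lemma half_small e (delta : R) : 0 < delta -> exists N : int, forall x y : X,
  (forall k, k <= N -> letter e x k = letter e y k) ->
  forall j, j <= 0 -> d (dshift e j x) (dshift e j y) <= delta.
Proof.
move=> /cylinder_small[N NP]; exists N%:Z => x y xy j j0; apply: NP => k kN.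
have := xy (dir e * k + j); rewrite /letter mulrDr dirK /dshift /= /shiftz; apply.
by move: kN; case: e {xy} => /=; lia.
Qed.

Lemma half_separates e : exists2 delta : R, 0 < delta & forall x y : X,
  (forall j, j <= 0 -> d (dshift e j x) (dshift e j y) <= delta) ->
  forall k, k <= 0 -> letter e x k = letter e y k.
Proof.
have [delta d0 dP] := metric_separates (locally_constant_letter (X := X) e 0).
exists delta => // x y xy k k0; have := dP _ _ (xy k k0).
by rewrite !letter_dshift add0r.
Qed.

Lemma pos_expansive_metric e phi : endomorphism phi ->
  pos_expansive e phi <-> exists2 delta : R, 0 < delta & forall x y : X,
    (forall (i : nat) j, j <= 0 ->
      d (dshift e j (iter i phi x)) (dshift e j (iter i phi y)) <= delta) -> x = y.
Proof.
move=> [cphi phiS]; split=> [pe|[delta d0 dP] x y xy].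
  have [delta d0 dP] := half_separates e; exists delta => // x y xy.
  by apply: pe => i; apply: dP; exact: xy.
have [N NP] := half_small e d0; apply: (@dshift_inj e _ _ (- N)).
apply: dP => i; apply: NP => k kN.
by rewrite !iter_dshift // !letter_dshift xy //; lia.
Qed.

Lemma orbit_expansive_metric e phi : endomorphism phi ->
  orbit_expansive e phi <-> exists2 delta : R, 0 < delta & forall x y : int -> X,
    is_orbit phi x -> is_orbit phi y ->
    (forall i j : int, j <= 0 ->
      d (dshift e j (x i)) (dshift e j (y i)) <= delta) -> x = y.
Proof.
move=> [cphi phiS]; split=> [pe|[delta d0 dP] x y ox oy xy].
  have [delta d0 dP] := half_separates e; exists delta => // x y ox oy xy.
  by apply: pe => // i; apply: dP; exact: xy.
have [N NP] := half_small e d0.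
have oS z : is_orbit phi z -> is_orbit phi (fun i => dshift e (- N) (z i)).
  by move=> oz i; rewrite (equivariant_dshift e _ _ phiS) oz.
apply/funext => i; apply: (@dshift_inj e _ _ (- N)); move: i; apply/funeqP.
apply: dP => [||i]; [exact: oS|exact: oS|].
by apply: NP => k kN; rewrite !letter_dshift xy //; lia.
Qed.

Lemma positively_left_expansiveE phi : endomorphism phi ->
  positively_left_expansive d phi <-> pos_expansive true phi.
Proof.
move=> ephi; rewrite (pos_expansive_metric _ ephi) /dshift /=.
by split=> -[delta d0 dP]; exists delta => // x y xy; apply: dP => i j j0;
  have := xy i j j0; rewrite mul1r.
Qed.

Lemma positively_right_expansiveE phi : endomorphism phi ->
  positively_right_expansive d phi <-> pos_expansive false phi.
Proof.
move=> ephi; rewrite (pos_expansive_metric _ ephi) /dshift /=.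
split=> -[delta d0 dP]; exists delta => // x y xy; apply: dP => i j j0;
  by have := xy i (- j); rewrite mulN1r ?opprK; apply; lia.
Qed.

Lemma left_expansiveE phi : endomorphism phi ->
  left_expansive d phi <-> orbit_expansive true phi.
Proof.
move=> ephi; rewrite (orbit_expansive_metric _ ephi) /dshift /=.
by split=> -[delta d0 dP]; exists delta => // x y ox oy xy; apply: dP => // i j j0;
  have := xy i j j0; rewrite mul1r.
Qed.

Lemma right_expansiveE phi : endomorphism phi ->
  right_expansive d phi <-> orbit_expansive false phi.
Proof.
move=> ephi; rewrite (orbit_expansive_metric _ ephi) /dshift /=.
split=> -[delta d0 dP]; exists delta => // x y ox oy xy; apply: dP => // i j j0;
  by have := xy i (- j); rewrite mulN1r ?opprK; apply; lia.
Qed.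

End Metric.

(** * Orbits, oriented graphs and part (2) *)

(** With [g] the identity this is the space of orbits of [f]; with [f], [g]
    induced by a textile system it consists of the sequences defining the
    textile set. *)
Lemma orbits_compact (A B : finType) (X : subshift A) (Y : subshift B)
    (f g : X -> Y) :
  continuous f -> continuous g ->
  compact [set u : {ptws int -> X} | forall i, f (u i) = g (u (i + 1))].
Proof.
move=> cf cg; apply: (@subclosed_compact _ _ [set: {ptws int -> X}]) => //; last first.
  suff : compact [set u : {ptws int -> X} | forall i, [set: X] (u i)].
    by congr compact; apply/seteqP; split.
  apply: (@tychonoff int (fun=> X) (fun=> setT)) => _; exact: subshift_compact.
have nearE (h : X -> Y) (u : {ptws int -> X}) (i k : int) :
    continuous h -> \forall v \near u, val (h (v i)) k = val (h (u i)) k.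
  move=> ch; have pc : continuous (fun v : {ptws int -> X} => v i).
    exact: (@proj_continuous int (fun=> X) i).
  exact: (locally_constant_comp pc (locally_constant_comp ch (locally_constant_val k))).
move=> u clu i; apply/val_inj/funext => k.
have fg_near := @filterI _ (nbhs u) (nbhs_filter u) _ _
  (nearE f u i k cf) (nearE g u (i + 1) k cg).
have [v [vfg [fv gv]]] := clu _ fg_near.
by rewrite -fv -gv vfg.
Qed.

Lemma ontoP (S T : Type) (f : S -> T) : onto f <-> forall y, exists x, f x = y.
Proof.
split=> [fO y|fO]; last by apply/seteqP; split=> // y _; have [x <-] := fO y; exists x.
have : range f y by rewrite [range f]fO; exact: Logic.I.
by case=> x _ <-; exists x.
Qed.

Lemma onto_orbit (A : finType) (X : subshift A) (phi : X -> X) (x : X) :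
  onto phi -> exists2 u : int -> X, is_orbit phi u & u 0 = x.
Proof.
move=> ophi; have ex_pre := (ontoP phi).1 ophi.
have [g gK] : exists g, cancel g phi.
  by exists (fun y => sval (cid (ex_pre y))) => y; case: cid.
exists (fun i => match i with Posz n => iter n phi x | Negz n => iter n.+1 g x end) => //.
case=> [n|[|n]].
- by rewrite addrC -intS.
- by rewrite /= gK.
- by rewrite (_ : Negz n.+1 + 1 = Negz n) /= ?gK //; lia.
Qed.

Lemma orbit_expansive_local e (A : finType) (X : subshift A) (phi : X -> X) :
  endomorphism phi -> orbit_expansive e phi ->
  exists N : nat, forall x y : int -> X, is_orbit phi x -> is_orbit phi y ->
    (forall i k : int, `|i| <= N%:Z -> k <= 0 -> letter e (x i) k = letter e (y i) k) ->
    letter e (x 0) 1 = letter e (y 0) 1.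
Proof.
move=> [cphi phiS] pe; have cid : continuous (id : X -> X) by move=> x; exact: cvg_id.
have lc i k : locally_constant (fun u : {ptws int -> X} => letter e (u i) k).
  have pc : continuous (fun v : {ptws int -> X} => v i).
    exact: (@proj_continuous int (fun=> X) i).
  exact: (locally_constant_comp pc (locally_constant_letter e k)).
have [j||x y ox oy xy|N NP] := @finite_determination {ptws int -> X} _ (int * nat) A A
  (fun j => absz j.1) (fun j u => letter e (u j.1) (- j.2%:Z))
  (fun u => letter e (u 0) 1) (orbits_compact cphi cid).
- exact: lc.
- exact: lc.
- suff -> : x = y by [].
  apply: pe => // i k k0; have := xy (i, absz k) => /=.
  by have -> : - (absz k)%:Z = k by lia.
- exists N => x y ox oy xy; apply: NP => // -[i k] /= iN; apply: xy; lia.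
Qed.

Lemma pos_expansive_local e (A : finType) (X : subshift A) (phi : X -> X) :
  endomorphism phi -> pos_expansive e phi ->
  exists n, determination_bound e phi n.
Proof.
move=> [cphi phiS] pe.
have [j||x y _ _ xy|n nP] := @finite_determination X setT (nat * nat) A A
  (fun j => maxn j.1 j.2) (fun j u => letter e (iter j.1 phi u) (- j.2%:Z))
  (fun u => letter e u 1) (@subshift_compact _ X).
- exact: (locally_constant_comp (iter_continuous cphi) (locally_constant_letter e _)).
- exact: locally_constant_letter.
- suff -> : x = y by [].
  apply: pe => // i k k0; have := xy (i, absz k) => /=.
  by have -> : - (absz k)%:Z = k by lia.
- exists n.+1 => x y k xy.
  have := nP (dshift e (k - 1) x) (dshift e (k - 1) y) Logic.I Logic.I.
  rewrite !letter_dshift (_ : 1 + (k - 1) = k); last by lia.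
  apply=> -[i j] /=; rewrite geq_max => /andP[ile jle].
  rewrite !iter_dshift // !letter_dshift addrC; apply: xy; lia.
Qed.

Definition src e (A : finType) (G : graph A) : A -> vertex G :=
  if e then @source A G else @target A G.

Definition tgt e (A : finType) (G : graph A) : A -> vertex G :=
  if e then @target A G else @source A G.

Lemma letter_path e (A : finType) (G : graph A) (z : path_shift G) k :
  tgt e G (letter e z k) = src e G (letter e z (k + 1)).
Proof.
have zP := set_mem (valP z); rewrite /letter; case: e => /=.
  by rewrite !mul1r; exact: zP.
by rewrite !mulN1r [in LHS](_ : - k = - (k + 1) + 1) ?zP //; lia.
Qed.

Lemma path_of_letters e (A : finType) (G : graph A) (f : int -> A) :
  (forall k, tgt e G (f k) = src e G (f (k + 1))) ->
  exists z : path_shift G, forall k, letter e z k = f k.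
Proof.
move=> fP; have zP : (fun k => f (dir e * k)) \in (path_shift G : set (fullshift A)).
  apply/mem_set => k; case: e fP => /= fP.
    by rewrite !mul1r fP.
  by rewrite !mulN1r fP; congr (target _ (f _)); lia.
exists (exist (fun x : fullshift A => x \in (path_shift G : set _)) _ zP) => k.
by rewrite /letter /= dirK.
Qed.

Lemma path_splice e (A : finType) (G : graph A) (x y : path_shift G) k :
  src e G (letter e x k) = src e G (letter e y k) ->
  exists z : path_shift G, (forall j, j < k -> letter e z j = letter e x j) /\
    (forall j, k <= j -> letter e z j = letter e y j).
Proof.
move=> xy; have [|z zE] := @path_of_letters e A G
  (fun j => if j < k then letter e x j else letter e y j).
  move=> j; have [jk|kj] := ltP j k; have [jk'|kj'] := ltP (j + 1) k;
    rewrite letter_path //; last by lia.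
  by have -> : j + 1 = k by lia.
exists z; split=> j jk; rewrite zE; first by rewrite jk.
by rewrite ltNge jk.
Qed.

Definition weakly_q_resolving e : textile_property := if e then weakly_qR else weakly_qL.
Definition q_resolving e : textile_property := if e then qR else qL.

Lemma weakly_q_resolvingP e (A : finType) (G : graph A) (T : textile_system G) :
  weakly_q_resolving e T <-> forall a b, src e (tgraph T) a = src e (tgraph T) b ->
    harc (tq T) a = harc (tq T) b -> a = b.
Proof. by case: e. Qed.

Lemma q_resolvingP e (A : finType) (G : graph A) (T : textile_system G) :
  q_resolving e T <-> forall (u : vertex (tgraph T)) (a : A), src e G a = hvertex (tq T) u ->
    exists! b, harc (tq T) b = a /\ src e (tgraph T) b = u.
Proof. by case: e. Qed.

Section Hom.
Context {A B : finType} {G : graph A} {Gamma : graph B} (h : graph_hom Gamma G).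

Lemma src_hom e b : src e G (harc h b) = hvertex h (src e Gamma b).
Proof. by case: e; [exact: hom_source|exact: hom_target]. Qed.

Lemma tgt_hom e b : tgt e G (harc h b) = hvertex h (tgt e Gamma b).
Proof. by case: e; [exact: hom_target|exact: hom_source]. Qed.

Lemma hom_map_continuous : continuous (hom_map h).
Proof.
apply: subshift_continuous => k; apply: locally_constant_eq (locally_constant_val k).
by move=> x y /= ->.
Qed.

Lemma hom_map_equivariant : equivariant (hom_map h).
Proof. by move=> z; exact: val_inj. Qed.

Lemma letter_hom_map e z k : letter e (hom_map h z) k = harc h (letter e z k).
Proof. by []. Qed.

End Hom.

Lemma q_resolving_weakly e (A : finType) (G : graph A) (T : textile_system G) :
  q_resolving e T -> weakly_q_resolving e T.
Proof.
move=> /q_resolvingP T_q; apply/weakly_q_resolvingP => a b ab qab.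
have [c [_ cP]] := T_q (src e (tgraph T) a) (harc (tq T) a) (src_hom _ _ _).
by rewrite -(cP a) // (cP b).
Qed.

Lemma invariant_dshift e (A : finType) (X : subshift A) (Z : set X) j x :
  @sigma _ X @` Z = Z -> Z x -> Z (dshift e j x).
Proof.
move=> ZS; rewrite /dshift; move: (dir e * j) => {}j.
have fwd y : Z y -> Z (sigmaz 1 y) by move=> Zy; rewrite -ZS; exists y.
have bwd y : Z y -> Z (sigmaz (-1) y).
  by rewrite -{1}ZS => -[z Zz <-]; rewrite /sigma -sigmazD addNr sigmaz0.
elim/int_rec: j => [|n IHn|n IHn] Zx.
- by rewrite sigmaz0.
- by rewrite intS sigmazD; exact/fwd/IHn.
- by rewrite intS opprD sigmazD; exact/bwd/IHn.
Qed.

Section WeaklyResolving.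
Context {A : finType} {X : subshift A} {phi : X -> X} {e : bool}.
Hypotheses (ephi : endomorphism phi) (ophi : onto phi).

(** The section [L] is the inverse of [p] on [Z]. Only its finite window is
    used later, and this comes from the compactness of [Z]. *)
Lemma weakly_resolving_lift : weakly_resolving (weakly_q_resolving e) phi ->
  exists (G : graph A) (T : textile_system G) (L : X -> path_shift (tgraph T)) (m : nat),
  [/\ weakly_q_resolving e T,
      forall x k, harc (tp T) (letter e (L x) k) = letter e x k,
      forall x k, harc (tq T) (letter e (L x) k) = letter e (phi x) k &
      forall x y k, (forall j : int, `|j| <= m%:Z -> letter e x (k + j) = letter e y (k + j)) ->
        letter e (L x) k = letter e (L y) k].
Proof.
move=> [G [T [Z [[T_wq clZ ZS] [p_inj pZ qZ phiE]]]]].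
have /choice[L LP] (x : X) : exists z, Z z /\ val (hom_map (tp T) z) = val x.
  have : (X : set _) (val x) by exact: set_mem (valP x).
  by rewrite -{1}pZ => -[z Zz zE]; exists z.
have pL x k : harc (tp T) (letter e (L x) k) = letter e x k.
  by rewrite -letter_hom_map /letter (LP x).2.
have cZ : compact Z.
  by apply: subclosed_compact (@subshift_compact _ _) _.
have [|m mP] := @factor_local e _ _ _ _ _ _ Z (hom_map (tp T)) id cZ
  (fun j x => @invariant_dshift e _ _ Z j x ZS) (@hom_map_continuous _ _ _ _ _)
  (@hom_map_equivariant _ _ _ _ _) (fun x => cvg_id) (fun x => erefl).
  by move=> x y Zx Zy; apply: p_inj; apply/mem_set.
exists G, T, L, m; split => //.
  by move=> x k; rewrite -letter_hom_map /letter (phiE x (L x)) //; apply LP.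
move=> x y k xy; apply: mP => [||j jm]; [exact: (LP x).1|exact: (LP y).1|].
by rewrite !letter_hom_map !pL xy.
Qed.

Theorem weakly_resolving_pos_expansive :
  weakly_resolving (weakly_q_resolving e) phi -> orbit_expansive e phi -> pos_expansive e phi.
Proof.
move=> /weakly_resolving_lift[G [T [L [m [/weakly_q_resolvingP T_wq pL qL L_local]]]]].
move=> /(orbit_expansive_local ephi)[N NP].
(* The path over [x] is read from left to right off its [q]-image [phi x]. *)
have lift_step x y k0 l :
    (forall k, k <= k0 -> letter e (L x) k = letter e (L y) k) ->
    (forall k, k <= l -> letter e (phi x) k = letter e (phi y) k) ->
    forall k, k <= l -> letter e x k = letter e y k.
  move=> xyL phixy k kl; rewrite -!pL; congr harc.
  suff H n : k0 + n%:Z <= l -> letter e (L x) (k0 + n%:Z) = letter e (L y) (k0 + n%:Z).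
    have [kk0|kk0] := leP k k0; first exact: xyL.
    have := H (absz (k - k0)); rewrite (_ : k0 + (absz (k - k0))%:Z = k); last by lia.
    exact.
  elim: n => [|n IHn] nl; first by apply: xyL; lia.
  have {}IHn := IHn (ltac:(lia)).
  have nE : k0 + n.+1%:Z = k0 + n%:Z + 1 by lia.
  apply: T_wq; last by rewrite !qL phixy.
  by rewrite nE -!letter_path IHn.
have column_step x y k0 :
    (forall i k, k <= k0 -> letter e (iter i phi x) k = letter e (iter i phi y) k) ->
    forall i k, k <= k0 + 1 -> letter e (iter i phi x) k = letter e (iter i phi y) k.
  move=> xy.
  (* The orbit expansiveness needs [N] rows on both sides, all in [i >= 0]. *)
  have high i : (N <= i)%N -> forall k, k <= k0 + 1 ->
      letter e (iter i phi x) k = letter e (iter i phi y) k.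
    move=> Ni k kk0; have [kle|kgt] := leP k k0; first exact: xy.
    have -> : k = 1 + k0 by lia.
    have [u ou ux] := onto_orbit x ophi; have [v ov vy] := onto_orbit y ophi.
    have uE n : u n%:Z = iter n phi x by rewrite -ux orbit_iter // add0r.
    have vE n : v n%:Z = iter n phi y by rewrite -vy orbit_iter // add0r.
    pose w (t : int -> X) j := dshift e k0 (t (j + i%:Z)).
    have ow t : is_orbit phi t -> is_orbit phi (w t).
      by move=> ot j; rewrite /w (equivariant_dshift _ _ _ ephi.2) ot addrAC.
    have := NP _ _ (ow u ou) (ow v ov); rewrite /w !letter_dshift add0r uE vE; apply.
    move=> j l jN l0; rewrite !letter_dshift.
    have -> : j + i%:Z = (absz (j + i%:Z))%:Z by lia.
    by rewrite uE vE xy //; lia.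
  move=> i; have [n Nn] : exists n, (N <= i + n)%N by exists N; rewrite leq_addl.
  elim: n i Nn => [|n IHn] i Nn; first by apply: high; rewrite addn0 in Nn.
  apply: (@lift_step _ _ (k0 - m%:Z)).
    by move=> k kle; apply: L_local => j jm; apply: xy; lia.
  by move=> k kle; rewrite -!iterS IHn // addSnnS.
move=> x y xy; apply: (@letterP e) => k.
suff H n : forall i k, k <= n%:Z -> letter e (iter i phi x) k = letter e (iter i phi y) k.
  by apply: (H (absz k) 0%N); lia.
elim: n => [|n IHn]; first exact: xy.
by move=> i l ln; apply: (column_step _ _ _ IHn); lia.
Qed.

End WeaklyResolving.

(** * Resolving homomorphisms onto a path shift *)

Section Covering.
Context {A B : finType} {Gamma : graph B} {G : graph A}.
Variables (e : bool) (q : graph_hom Gamma G).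

Definition arcs_from (V : {set vertex Gamma}) (a : A) : {set B} :=
  [set b | (src e Gamma b \in V) && (harc q b == a)]%SET.

(** The terminal vertices of the lifts to [Gamma] of the first [k] arcs of [y],
    the lifts starting anywhere. *)
Fixpoint ends (y : path_shift G) (k : nat) : {set vertex Gamma} :=
  if k is k'.+1 then
    [set tgt e Gamma b | b in arcs_from (ends y k') (letter e y k'%:Z)]%SET
  else [set: vertex Gamma]%SET.

Lemma ends_eq y y' k :
  (forall j, j < k%:Z -> letter e y j = letter e y' j) -> ends y k = ends y' k.
Proof.
elim: k => [//|k IHk] yy' /=; rewrite yy' ?IHk //; last by lia.
by move=> j jk; apply: yy'; lia.
Qed.

Lemma ends_lift z k : src e Gamma (letter e z k%:Z) \in ends (hom_map q z) k.
Proof.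
elim: k => [|k IHk]; first exact: finset.in_setT.
rewrite /= (_ : k.+1%:Z = k%:Z + 1) -?letter_path; last by lia.
by apply: imset_f; rewrite inE IHk letter_hom_map eqxx.
Qed.

Lemma ends_src y k u :
  u \in ends y k.+1 -> src e G (letter e y k.+1%:Z) = hvertex q u.
Proof.
case/imsetP => b; rewrite inE => /andP[_ /eqP qb] ->.
by rewrite -tgt_hom qb letter_path; congr (src _ _ (letter _ _ _)); lia.
Qed.

Hypothesis q_inj :
  forall a b, src e Gamma a = src e Gamma b -> harc q a = harc q b -> a = b.

Lemma card_arcs_from V a : #|arcs_from V a| = #|src e Gamma @: arcs_from V a|.
Proof.
rewrite card_in_imset // => b b'; rewrite !inE => /andP[_ /eqP qb] /andP[_ /eqP qb'] bb'.
by apply: q_inj; rewrite // qb qb'.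
Qed.

Lemma src_arcs_from_sub V a : src e Gamma @: arcs_from V a \subset V.
Proof. by apply/fintype.subsetP => u /imsetP[b]; rewrite inE => /andP[bV _] ->. Qed.

Lemma card_endsS y k : (#|ends y k.+1| <= #|ends y k|)%N.
Proof.
apply: leq_trans (leq_imset_card _ _) _; rewrite card_arcs_from.
exact: (subset_leq_card (src_arcs_from_sub _ _)).
Qed.

(** Arcs leaving a set of vertices over a fixed arc of [G] are determined by
    their sources, so the number of end vertices never grows, and it drops as
    soon as one vertex has no continuation. *)
Lemma card_endsS_lt y k u : u \in ends y k ->
  ~ (exists b, harc q b = letter e y k%:Z /\ src e Gamma b = u) ->
  (#|ends y k.+1| < #|ends y k|)%N.
Proof.
move=> uk ub; apply: leq_ltn_trans (leq_imset_card _ _) _; rewrite card_arcs_from.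
apply: proper_card; apply/fintype.properP; split; first exact: src_arcs_from_sub.
exists u => //; apply/imsetP => -[b]; rewrite inE => /andP[_ /eqP qb] bu.
by apply: ub; exists b.
Qed.

Lemma card_ends_leq y k n : (#|ends y (k + n)| <= #|ends y k|)%N.
Proof.
elim: n => [|n IHn]; rewrite ?addn0 ?addnS //.
exact: leq_trans (card_endsS _ _) IHn.
Qed.

Hypothesis q_onto : forall y, exists z, hom_map q z = y.
Hypothesis G_essential : forall a, exists y : path_shift G, letter e y 0 = a.
Hypothesis Gamma_connected : forall u v : vertex Gamma,
  exists (z : path_shift Gamma) (n : nat),
    src e Gamma (letter e z 0) = u /\ src e Gamma (letter e z n%:Z) = v.

Lemma ends_gt0 y k : (0 < #|ends y k|)%N.
Proof.
have [z <-] := q_onto y; apply/card_gt0P.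
by exists (src e Gamma (letter e z k%:Z)); exact: ends_lift.
Qed.

(** A vertex [u] with no arc over [a] would allow the number of end vertices of
    a path to be lowered indefinitely, which is absurd as every path lifts. *)
Theorem onto_covering u a : src e G a = hvertex q u ->
  exists b, harc q b = a /\ src e Gamma b = u.
Proof.
move=> au; apply: contrapT => no_b.
suff no_ends m y k : (#|ends y k.+1| <= m)%N -> False.
  have [z [n _]] := Gamma_connected u u.
  exact: (no_ends _ (hom_map q z) 0%N (leqnn _)).
elim: m y k => [|m IHm] y k ends_m.
  by have := ends_gt0 y k.+1; rewrite lt0n -leqn0 ends_m.
have /card_gt0P[v vk] := ends_gt0 y k.+1.
have [z [n [zv zu]]] := Gamma_connected v u.
(* [y1] follows [y] up to the end vertex [v], then the image of a path to [u]. *)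
have [|y1 [y1y y1z]] := @path_splice e _ G y (dshift e (- k.+1%:Z) (hom_map q z)) k.+1%:Z.
  by rewrite (ends_src vk) letter_dshift subrr letter_hom_map src_hom zv.
have y1E j : letter e y1 (k.+1 + j)%N%:Z = harc q (letter e z j%:Z).
  rewrite y1z ?letter_dshift ?letter_hom_map; last by lia.
  by congr (harc _ (letter _ _ _)); lia.
have ends_y1 : ends y1 k.+1 = ends y k.+1 by exact: ends_eq.
have u_end j : src e Gamma (letter e z j%:Z) \in ends y1 (k.+1 + j).
  elim: j => [|j IHj]; first by rewrite addn0 ends_y1 zv.
  rewrite addnS (_ : j.+1%:Z = j%:Z + 1) -?letter_path; last by lia.
  by apply: imset_f; rewrite inE IHj y1E eqxx.
have [ya yaE] := G_essential a.
(* Continuing [y1] with [a] leaves the end vertex [u] without continuation. *)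
have [|y2 [y2y1 y2a]] := @path_splice e _ G y1 (dshift e (- (k.+1 + n)%N%:Z) ya) (k.+1 + n)%N%:Z.
  by rewrite letter_dshift subrr yaE au y1E src_hom zu.
apply: (IHm y2 (k.+1 + n)%N); rewrite -ltnS; apply: leq_trans ends_m.
rewrite -ends_y1; apply: leq_trans (card_ends_leq y1 k.+1 n).
have ends_y2 : ends y2 (k.+1 + n) = ends y1 (k.+1 + n) by exact: ends_eq.
rewrite -ends_y2; apply: (@card_endsS_lt y2 _ u).
  by rewrite ends_y2 -zu.
by rewrite y2a // letter_dshift subrr yaE.
Qed.

End Covering.

(** * Conjugacies and textile sets *)

Section Conjugacy.
Context {A B : finType} {X : subshift A} {Y : subshift B} (theta : X -> Y).
Hypothesis ctheta : conjugacy theta.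

Lemma conjugacy_continuous : continuous theta.
Proof. by case: ctheta => -[]. Qed.

Lemma conjugacy_equivariant : equivariant theta.
Proof. by case: ctheta. Qed.

Lemma conjugacy_inj : injective theta.
Proof. by case: ctheta => -[_ [g [_ thetaK _]]] _; exact: can_inj thetaK. Qed.

Lemma conjugacy_inverse : exists theta' : Y -> X,
  [/\ conjugacy theta', cancel theta theta' & cancel theta' theta].
Proof.
case: ctheta => -[cth [g [cg thetaK gK]]] thS; exists g; split => //; split.
  by split=> //; exists theta.
by move=> y; rewrite -{1}(gK y) -[sigma (theta _)]thS thetaK.
Qed.

Section Semiconjugate.
Variables (phi : X -> X) (psi : Y -> Y).
Hypothesis phi_psi : forall x, theta (phi x) = psi (theta x).

Lemma conj_iter i x : theta (iter i phi x) = iter i psi (theta x).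
Proof. by elim: i => //= i <-. Qed.

(** The window of the conjugacy costs [m] columns, which are recovered by
    shifting both points. *)
Lemma conj_pos_expansive e :
  equivariant phi -> pos_expansive e psi -> pos_expansive e phi.
Proof.
move=> phiS pe x y xy.
have [m mP] := endomorphism_local e conjugacy_continuous conjugacy_equivariant.
apply: (@dshift_inj e _ _ (- m%:Z)); apply: conjugacy_inj; apply: pe => i k k0.
rewrite -!conj_iter !iter_dshift //; apply: mP => j jm.
by rewrite !letter_dshift xy //; lia.
Qed.

Lemma conj_orbit_expansive e :
  equivariant phi -> orbit_expansive e psi -> orbit_expansive e phi.
Proof.
move=> phiS pe x y ox oy xy.
have [m mP] := endomorphism_local e conjugacy_continuous conjugacy_equivariant.
have oth z : is_orbit phi z -> is_orbit psi (fun i => theta (dshift e (- m%:Z) (z i))).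
  by move=> oz i; rewrite -phi_psi (equivariant_dshift _ _ _ phiS) oz.
apply/funext => i; apply: (@dshift_inj e _ _ (- m%:Z)); apply: conjugacy_inj.
move: i; apply/funeqP/pe; [exact: oth|exact: oth|].
move=> i k k0; apply: mP => j jm.
by rewrite !letter_dshift xy //; lia.
Qed.

End Semiconjugate.

Lemma conj_transport (phi : X -> X) : endomorphism phi ->
  exists psi : Y -> Y, endomorphism psi /\ forall x, theta (phi x) = psi (theta x).
Proof.
move=> [cphi phiS]; have [theta' [[[cth' _] th'S] thK th'K]] := conjugacy_inverse.
exists (theta \o phi \o theta'); split; last by move=> x /=; rewrite thK.
split=> [y|y /=]; last by rewrite th'S phiS conjugacy_equivariant.
apply: continuous_comp; first exact: cth'.
by apply: continuous_comp; [exact: cphi|exact: conjugacy_continuous].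
Qed.

Lemma conj_onto (phi : X -> X) (psi : Y -> Y) :
  (forall x, theta (phi x) = psi (theta x)) -> onto phi -> onto psi.
Proof.
move=> phi_psi /ontoP phiO; apply/ontoP => y.
have [theta' [_ thK th'K]] := conjugacy_inverse.
have [x xE] := phiO (theta' y); exists (theta x).
by rewrite -phi_psi xE th'K.
Qed.

Lemma conj_inj (phi : X -> X) (psi : Y -> Y) :
  (forall x, theta (phi x) = psi (theta x)) -> injective phi -> injective psi.
Proof.
move=> phi_psi phiI; have [theta' [_ thK th'K]] := conjugacy_inverse.
move=> y y'; rewrite -(th'K y) -(th'K y') -!phi_psi.
by move=> /conjugacy_inj /phiI ->.
Qed.

Lemma conj_transitive :
  topologically_transitive X -> topologically_transitive Y.
Proof.
move=> trX U V oU oV [u Uu] [v Vv].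
have [theta' [_ thK th'K]] := conjugacy_inverse.
have cth := conjugacy_continuous.
have [||||n [_ [[x /= Ux <-] Vx]]] := trX (theta @^-1` U) (theta @^-1` V).
- by apply: open_comp => // x _; exact: cth.
- by apply: open_comp => // x _; exact: cth.
- by exists (theta' u); rewrite /= th'K.
- by exists (theta' v); rewrite /= th'K.
exists n, (theta (iter n (@sigma A X) x)); split=> //.
exists (theta x) => //; elim: n {Vx} => //= n ->.
by rewrite conjugacy_equivariant.
Qed.

End Conjugacy.

Lemma conjugacy_comp (A B C : finType) (X : subshift A) (Y : subshift B)
    (W : subshift C) (f : X -> Y) (g : Y -> W) :
  conjugacy f -> conjugacy g -> conjugacy (g \o f).
Proof.
move=> cf cg; have [f' [_ fK f'K]] := conjugacy_inverse cf.
have [g' [_ gK g'K]] := conjugacy_inverse cg.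
apply: bijective_conjugacy.
- move=> x; apply: continuous_comp; exact: conjugacy_continuous.
- by move=> x /=; rewrite !conjugacy_equivariant.
- exact: inj_comp (conjugacy_inj cg) (conjugacy_inj cf).
- by move=> w; exists (f' (g' w)); rewrite /= f'K g'K.
Qed.

Lemma conj_weakly_resolving_pos_expansive e (A B : finType) (X : subshift A)
    (Y : subshift B) (theta : X -> Y) (phi : X -> X) (psi : Y -> Y) :
  conjugacy theta -> (forall x, theta (phi x) = psi (theta x)) ->
  endomorphism phi -> endomorphism psi -> onto phi ->
  weakly_resolving (weakly_q_resolving e) psi -> orbit_expansive e phi -> pos_expansive e phi.
Proof.
move=> cth phi_psi ephi epsi ophi wpsi oe.
have [theta' [cth' thK th'K]] := conjugacy_inverse cth.
apply: (conj_pos_expansive cth phi_psi ephi.2).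
apply: weakly_resolving_pos_expansive => //; first exact: (conj_onto cth phi_psi).
by apply: (conj_orbit_expansive cth' _ epsi.2 oe) => y; rewrite -{1}(th'K y) -phi_psi thK.
Qed.

Lemma essentially_conj P (A B : finType) (X : subshift A) (Y : subshift B)
    (theta : X -> Y) (phi : X -> X) (psi : Y -> Y) :
  conjugacy theta -> (forall x, theta (phi x) = psi (theta x)) ->
  essentially P psi -> essentially P phi.
Proof.
move=> cth phi_psi [C [G [chi [eta [ndG [echi ochi rchi ceta psi_chi]]]]]].
exists C, G, chi, (eta \o theta); split=> //; split=> //.
  exact: conjugacy_comp.
by move=> x /=; rewrite phi_psi psi_chi.
Qed.

Lemma image_subshift (A B : finType) (X : subshift A) (t : X -> fullshift B) :
  (forall k, locally_constant (fun x => t x k)) ->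
  (forall x, t (sigma x) = Defs.shift (t x)) ->
  exists (Y : subshift B) (theta : X -> Y),
    [/\ forall x, val (theta x) = t x, continuous theta, equivariant theta &
        forall y, exists x, theta x = y].
Proof.
move=> lt tS; have ct := coordwise_continuous lt.
have clT : closed (range t).
  apply: compact_closed; first exact: fullshift_hausdorff.
  apply: continuous_compact; last exact: subshift_compact.
  exact: continuous_subspaceT.
have invT : @Defs.shift B @` range t = range t.
  apply/seteqP; split=> [_ [_ [x _ <-] <-]|_ [x _ <-]].
    by exists (sigma x) => //; rewrite tS.
  exists (t (sigmaz (-1) x)); first by exists (sigmaz (-1) x).
  by rewrite -tS /sigma -sigmazD subrr sigmaz0.
have tT x : t x \in (Subshift clT invT : set (fullshift B)) by apply/mem_set; exists x.
exists (Subshift clT invT), (fun x => exist _ (t x) (tT x)); split=> //.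
- exact: subshift_continuous.
- by move=> x; apply: val_inj; exact: tS.
- move=> [y yT]; have [x _ xy] := set_mem yT; exists x; exact: val_inj.
Qed.

Lemma transitive_dshift e (A : finType) (X : subshift A) (U V : set X) :
  topologically_transitive X -> open U -> open V -> U !=set0 -> V !=set0 ->
  exists (x : X) (n : nat), U x /\ V (dshift e n%:Z x).
Proof.
move=> trX; have iter_sigma n x : iter n (@sigma A X) x = sigmaz n%:Z x.
  by elim: n => [|n IHn]; rewrite ?sigmaz0 //= IHn intS sigmazD.
case: e => oU oV U0 V0.
  have [n [_ [[x Ux <-] Vx]]] := trX U V oU oV U0 V0.
  by exists x, n; rewrite /dshift mul1r -iter_sigma.
have [n [_ [[x Vx <-] Ux]]] := trX V U oV oU V0 U0.
exists (iter n (@sigma A X) x), n; split=> //.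
by rewrite /dshift mulN1r iter_sigma -sigmazD addNr sigmaz0.
Qed.

(** The textile set is the projection to one coordinate of a compact space of
    sequences. *)
Lemma textile_set_closed (A : finType) (G : graph A) (T : textile_system G) :
  closed (textile_set T).
Proof.
have cO := orbits_compact (@hom_map_continuous _ _ _ _ (tq T))
  (@hom_map_continuous _ _ _ _ (tp T)).
suff -> : textile_set T = (fun u : {ptws int -> path_shift (tgraph T)} => u 0) @`
    [set u | forall i, hom_map (tq T) (u i) = hom_map (tp T) (u (i + 1))].
  apply: compact_closed; first exact: subshift_hausdorff.
  apply: continuous_compact cO; apply: continuous_subspaceT.
  exact: (@proj_continuous int (fun=> path_shift (tgraph T)) 0).
apply/seteqP; split=> [z [u [u0 uE]]|_ [u uE <-]].
  by exists u => // i /=; rewrite -uE addrK.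
by exists u; split=> // i; rewrite uE subrK.
Qed.

Lemma resolving_weakly_resolving P wP (A : finType) (G : graph A)
    (phi : path_shift G -> path_shift G) :
  (forall T : textile_system G, P A G T -> wP A G T) ->
  resolving P phi -> weakly_resolving wP phi.
Proof.
move=> PwP [T [TP [pO pI phiE]]].
exists G, T, (textile_set T); split; split=> //.
- exact: PwP.
- exact: textile_set_closed.
- apply/seteqP; split=> [_ [z [u [u0 uE]] <-]|z [u [u0 uE]]].
    exists (fun i => sigma (u i)); rewrite u0; split=> // i.
    by rewrite !hom_map_equivariant uE.
  exists (sigmaz (-1) z); last by rewrite /sigma -sigmazD subrr sigmaz0.
  exists (fun i => sigmaz (-1) (u i)); rewrite u0; split=> // i.
  by rewrite !(equivariant_sigmaz _ _ (@hom_map_equivariant _ _ _ _ _)) uE.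
- apply/seteqP; split=> [_ [z _ <-]|x Gx]; first exact: set_mem (valP _).
  have : [set: path_shift G] (exist _ x (mem_set Gx)) by [].
  by rewrite -pO => -[z Tz /(congr1 val) /= zx]; exists z.
- by move=> _ [z _ <-]; exact: set_mem (valP _).
- move=> x z Tz zx; rewrite (phiE x z) //; exact: val_inj.
Qed.

(** * Pattern graphs and part (1) *)

Section Patterns.
Variables (e : bool) (A : finType) (X : subshift A) (phi : X -> X).

Definition block (r s : nat) (x : X) : {ffun 'I_r * 'I_s -> A} :=
  [ffun p : 'I_r * 'I_s => letter e (iter p.1 phi x) p.2%:Z].

(** Only patterns occurring in [X] are admitted: the local determination of a
    letter, on which weak resolvingness rests, can fail for arbitrary arrays. *)
Definition pattern (r s : nat) : finType :=
  {w : {ffun 'I_r * 'I_s -> A} | `[< exists x, block r s x = w >]}.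

Definition pattern_at (r s : nat) (x : X) : pattern r s :=
  exist _ (block r s x) (asboolT (ex_intro _ x erefl)).

Lemma blockP r s x y : block r s x = block r s y <->
  forall i j : nat, (i < r)%N -> (j < s)%N ->
    letter e (iter i phi x) j%:Z = letter e (iter i phi y) j%:Z.
Proof.
split=> [/ffunP xy i j ir js|xy]; last by apply/ffunP => -[i j]; rewrite !ffunE xy.
by have := xy (Ordinal ir, Ordinal js); rewrite !ffunE.
Qed.

Lemma pattern_atP r s x y : pattern_at r s x = pattern_at r s y <->
  forall i j : nat, (i < r)%N -> (j < s)%N ->
    letter e (iter i phi x) j%:Z = letter e (iter i phi y) j%:Z.
Proof.
rewrite -blockP; split=> [/(congr1 val) //|xy]; exact: val_inj.
Qed.

Lemma patternP r s (w : pattern r s) : exists x, pattern_at r s x = w.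
Proof. by case: w => w wP; have [x xw] := asboolW wP; exists x; exact: val_inj. Qed.

Definition occurrence r s (w : pattern r s) : X := sval (cid (patternP w)).

Lemma occurrenceK r s : cancel (@occurrence r s) (pattern_at r s).
Proof. by move=> w; rewrite /occurrence; case: cid. Qed.

(** The part of a pattern from row [i] and column [j] on, taken from a point in
    which the pattern occurs; when it fits into the pattern, the choice of the
    point is immaterial by [subpattern_at]. *)
Definition subpattern r s r' s' (i j : nat) (w : pattern r s) : pattern r' s' :=
  pattern_at r' s' (dshift e j%:Z (iter i phi (occurrence w))).

Hypothesis ephi : endomorphism phi.
Let cphi : continuous phi := ephi.1.
Let phiS : equivariant phi := ephi.2.

Lemma subpattern_at r s r' s' i j x : (i + r' <= r)%N -> (j + s' <= s)%N ->
  subpattern r' s' i j (pattern_at r s x) = pattern_at r' s' (dshift e j%:Z (iter i phi x)).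
Proof.
move=> ir js; apply/pattern_atP => i' j' ir' js'.
rewrite !iter_dshift // !letter_dshift -!iterD -PoszD.
have /pattern_atP := occurrenceK (pattern_at r s x); apply; lia.
Qed.

Lemma locally_constant_block r s : locally_constant (block r s).
Proof.
apply: locally_constant_finfun => -[i j] x.
apply: filterS (locally_constant_comp (iter_continuous (i := i) cphi)
  (locally_constant_letter e j%:Z) x) => y.
by rewrite !ffunE.
Qed.

Lemma locally_constant_pattern_at r s : locally_constant (pattern_at r s).
Proof.
apply: locally_constant_eq (@locally_constant_block r s) => x y xy; exact: val_inj.
Qed.

(** Exchanging source and target for [e = false] keeps [src e] the part of a
    pattern that comes first in the direction [e]. *)
Definition pattern_graph r s : graph (pattern r s.+1) :=
  Graph (fun w => subpattern r s 0 (if e then 0 else 1) w)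
        (fun w => subpattern r s 0 (if e then 1 else 0) w).

Lemma src_pattern r s x :
  src e (pattern_graph r s) (pattern_at r s.+1 x) = pattern_at r s x.
Proof.
have -> : src e (pattern_graph r s) = @subpattern r s.+1 r s 0 0.
  by rewrite /src /=; case: e.
by rewrite subpattern_at //= dshift0.
Qed.

Lemma tgt_pattern r s x :
  tgt e (pattern_graph r s) (pattern_at r s.+1 x) = pattern_at r s (dshift e 1 x).
Proof.
have -> : tgt e (pattern_graph r s) = @subpattern r s.+1 r s 0 1.
  by rewrite /tgt /=; case: e.
by rewrite subpattern_at.
Qed.

Lemma pattern_path_subproof r s x :
  (fun k => pattern_at r s.+1 (sigmaz k x)) \in
    (path_shift (pattern_graph r s) : set (fullshift _)).
Proof.
have [z zE] : exists z : path_shift (pattern_graph r s),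
    forall k, letter e z k = pattern_at r s.+1 (dshift e k x).
  apply: path_of_letters => k.
  by rewrite src_pattern tgt_pattern -dshiftD addrC.
have -> : (fun k => pattern_at r s.+1 (sigmaz k x)) = val z; last exact: valP z.
by apply/funext => k; have := zE (dir e * k); rewrite /letter /dshift !dirK => ->.
Qed.

Definition pattern_path r s (x : X) : path_shift (pattern_graph r s) :=
  exist _ (fun k => pattern_at r s.+1 (sigmaz k x)) (pattern_path_subproof r s x).

Lemma letter_pattern_path r s x k :
  letter e (pattern_path r s x) k = pattern_at r s.+1 (dshift e k x).
Proof. by []. Qed.

Lemma pattern_path_continuous r s : continuous (pattern_path r s).
Proof.
apply: subshift_continuous => k.
exact: (locally_constant_comp (@sigmaz_continuous _ X k)
  (@locally_constant_pattern_at r s.+1)).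
Qed.

Lemma pattern_path_equivariant r s : equivariant (pattern_path r s).
Proof.
move=> x; apply/val_inj/funext => k /=.
by rewrite /shiftz /= /sigma -sigmazD.
Qed.

Lemma pattern_at_letter r s x y :
  pattern_at r.+1 s.+1 x = pattern_at r.+1 s.+1 y -> letter e x 0 = letter e y 0.
Proof. by move=> /pattern_atP /(_ 0%N 0%N); apply. Qed.

Lemma pattern_path_inj r s : injective (pattern_path r.+1 s).
Proof.
move=> x y xy; apply: (@letterP e) => k.
have /pattern_at_letter := congr1 (fun z => letter e z k) xy.
by rewrite !letter_dshift add0r.
Qed.

Lemma pattern_hom_subproof (d : bool) r s (w : pattern r.+1 s.+1) i :
  (i <= 1)%N ->
  subpattern r s 0 i (subpattern r s.+1 d 0 w) =
  subpattern r s d 0 (subpattern r.+1 s 0 i w).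
Proof.
move=> i1; have [x <-] := patternP w.
have [d1 d0] : (d + r <= r.+1)%N /\ (0 + r <= r)%N by case: d.
rewrite !subpattern_at //=; [|lia..].
by rewrite !dshift0 iter_dshift.
Qed.

(** [d = false] forgets the last row, [d = true] the first. *)
Definition pattern_hom (d : bool) r s :
    graph_hom (pattern_graph r.+1 s) (pattern_graph r s) :=
  @GraphHom _ _ (pattern_graph r.+1 s) (pattern_graph r s)
    (fun w => subpattern r s.+1 d 0 w) (fun u => subpattern r s d 0 u)
    (fun w => @pattern_hom_subproof d r s w (if e then 0 else 1) ltac:(by case: e))
    (fun w => @pattern_hom_subproof d r s w (if e then 1 else 0) ltac:(by case: e)).

Lemma subpattern_row (d : nat) r s x : (d <= 1)%N ->
  subpattern r s d 0 (pattern_at r.+1 s x) = pattern_at r s (iter d phi x).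
Proof. by move=> d1; rewrite subpattern_at ?dshift0 //; lia. Qed.

Lemma hom_map_pattern_path d r s x :
  hom_map (pattern_hom d r s) (pattern_path r.+1 s x) = pattern_path r s (iter d phi x).
Proof.
apply/val_inj/funext => k /=.
rewrite subpattern_row; last by case: d.
by rewrite (equivariant_sigmaz _ _ (equivariant_iter _ phiS)).
Qed.

(** The source and the image under [q] of an arc leave a single letter unknown,
    in the first row and the last column; the columns of the source to the left
    of it determine it. *)
Lemma pattern_hom_resolving n s : determination_bound e phi n -> (n <= s)%N ->
  forall a b, src e (pattern_graph n.+2 s) a = src e (pattern_graph n.+2 s) b ->
    harc (pattern_hom true n.+1 s) a = harc (pattern_hom true n.+1 s) b -> a = b.
Proof.
move=> nP ns a b; have [x <-] := patternP a; have [y <-] := patternP b.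
rewrite !src_pattern /= !subpattern_row // => /pattern_atP xy /pattern_atP phixy.
apply/pattern_atP => -[|i] j ir; last first.
  by move=> js; rewrite !iterSr; exact: phixy.
rewrite ltnS leq_eqVlt => /orP[/eqP ->|js]; last exact: xy.
apply: nP => i' j' i'n j'n.
rewrite (_ : s%:Z - 1 - j'%:Z = (s - j'.+1)%N%:Z); last by lia.
by apply: xy; lia.
Qed.

End Patterns.

(** The target of [p] and [q] is a graph with one vertex and all patterns as
    arcs, so that the alphabet of the conjugate subshift has at least two
    letters even if [X] has a single point. *)
Theorem pos_expansive_essentially_weakly e (A : finType) (X : subshift A)
    (phi : X -> X) :
  (1 < #|A|)%N -> endomorphism phi -> pos_expansive e phi ->
  essentially_weakly (weakly_q_resolving e) phi.
Proof.
move=> A1 ephi pe; have [n nP] := pos_expansive_local ephi pe.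
have cphi := ephi.1; have phiS : equivariant phi := ephi.2.
pose B : finType := {ffun 'I_n.+1 * 'I_n.+1 -> A}.
pose t (x : X) : fullshift B := fun k => block e phi n.+1 n.+1 (sigmaz k x).
have [||Y [theta [thetaE cth thS thO]]] := @image_subshift A B X t.
- move=> k; exact: (locally_constant_comp (@sigmaz_continuous _ X k)
    (@locally_constant_block e A X phi ephi n.+1 n.+1)).
- by move=> x; apply/funext => k; rewrite /t /Defs.shift /shiftz /sigma -sigmazD.
have thI : injective theta.
  move=> x y /(congr1 val); rewrite !thetaE => /funeqP xy.
  apply: (@letterP e) => k; have /blockP/(_ 0%N 0%N isT isT) := xy (dir e * k).
  by rewrite /= -!/(dshift e k _) !letter_dshift add0r.
have cjth := bijective_conjugacy cth thS thI thO.
have [psi [epsi phi_psi]] := conj_transport cjth ephi.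
exists B, Y, psi, theta; split.
  rewrite card_ffun card_prod !card_ord; apply: (leq_trans A1).
  by rewrite -[X in (X <= _)%N]expn1 leq_exp2l.
split=> //.
pose G : graph B := @Graph B unit (fun=> tt) (fun=> tt).
pose Gamma := pattern_graph e phi n.+2 n.
pose hom (d : bool) : graph_hom Gamma G := @GraphHom _ _ Gamma G
  (fun w => val (subpattern n.+1 n.+1 d 0 w)) (fun=> tt) (fun=> erefl) (fun=> erefl).
pose T : textile_system G := TextileSystem (hom false) (hom true).
pose path := pattern_path e ephi n.+2 n.
have homE d x : val (hom_map (hom d) (path x)) = val (theta (iter d phi x)).
  apply/funext => k; rewrite thetaE /t.
  transitivity (val (subpattern n.+1 n.+1 d 0 (pattern_at e phi n.+2 n.+1 (sigmaz k x)))) => //.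
  rewrite subpattern_row //; last by case: d.
  by rewrite (equivariant_sigmaz _ _ (equivariant_iter _ phiS)).
have tpE x : val (hom_map (tp T) (path x)) = val (theta x) := homE false x.
have tqE x : val (hom_map (tq T) (path x)) = val (theta (phi x)) := homE true x.
exists G, T, (range path); split; split.
- apply/weakly_q_resolvingP => a b ab qab; apply: (pattern_hom_resolving nP (leqnn n) ab).
  exact: val_inj.
- apply: compact_closed; first exact: subshift_hausdorff.
  apply: continuous_compact; last exact: subshift_compact.
  exact/continuous_subspaceT/pattern_path_continuous.
- apply/seteqP; split=> [_ [_ [x _ <-] <-]|_ [x _ <-]].
    by exists (sigma x) => //; exact: pattern_path_equivariant.
  exists (path (sigmaz (-1) x)); first by exists (sigmaz (-1) x).
  rewrite -[LHS]pattern_path_equivariant /sigma -sigmazD subrr.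
  by rewrite sigmaz0.
- move=> _ _ /set_mem[x _ <-] /set_mem[y _ <-] /(congr1 val).
  by rewrite !tpE => /val_inj/thI ->.
- apply/seteqP; split=> [_ [_ [x _ <-] <-]|y Yy].
    by rewrite tpE; exact: set_mem (valP _).
  have [x xy] := thO (exist _ y (mem_set Yy)).
  by exists (path x); [exists x|rewrite tpE xy].
- by move=> _ [_ [x _ <-] <-]; rewrite tqE; exact: set_mem (valP _).
- move=> y _ [x _ <-]; rewrite tpE tqE => /val_inj <-.
  by rewrite phi_psi.
Qed.

(** * Pattern graphs of a Markov shift and part (3) *)

Section MarkovShift.
Variables (e : bool) (A : finType) (G : graph A).
Variable phi : path_shift G -> path_shift G.
Hypothesis ephi : endomorphism phi.
Let phiS : equivariant phi := ephi.2.
Notation X := (path_shift G).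

Definition iterates_local (r m : nat) := forall (i : nat) (x y : X) k, (i < r)%N ->
  (forall j : int, `|j| <= m%:Z -> letter e x (k + j) = letter e y (k + j)) ->
  letter e (iter i phi x) k = letter e (iter i phi y) k.

Lemma iterates_localP r : exists m, iterates_local r m.
Proof.
elim: r => [|r [m mP]]; first by exists 0%N => i.
have [m' m'P] := endomorphism_local e (iter_continuous (i := r) ephi.1)
  (equivariant_iter r phiS).
exists (maxn m m') => i x y k; rewrite ltnS leq_eqVlt => /orP[/eqP ->|ir] xy.
  by apply: m'P => j jm; apply: xy; lia.
by apply: mP => // j jm; apply: xy; lia.
Qed.

(** A path of patterns overlaps consistently, so its first letters form a path
    of [G], that is a point [x]. Its images under the iterates of [phi] are
    the other rows of the patterns, because the patterns are wide enough to
    contain the windows of these iterates. *)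
Lemma pattern_path_onto r s m : iterates_local r.+1 m -> (m.*2 < s)%N ->
  forall z, exists x, pattern_path e ephi r.+1 s x = z.
Proof.
move=> mP ms z.
pose w k : X := occurrence (letter e z k).
have wE k : pattern_at e phi r.+1 s.+1 (w k) = letter e z k by exact: occurrenceK.
(* The target of each pattern of [z] is the source of the next one. *)
have overlap1 k i j : (i <= r)%N -> (j < s)%N ->
    letter e (iter i phi (w k)) (j.+1%:Z) = letter e (iter i phi (w (k + 1))) j%:Z.
  move=> ir js; have := letter_path e z k.
  rewrite -!wE src_pattern // tgt_pattern // => /pattern_atP/(_ i j ir js).
  by rewrite iter_dshift // letter_dshift (_ : j.+1%:Z = j%:Z + 1) //; lia.
have overlap k i l : (i <= r)%N -> (l <= s)%N ->
    letter e (iter i phi (w k)) l%:Z = letter e (iter i phi (w (k + l%:Z))) 0.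
  move=> ir; elim: l k => [|l IHl] k ls; first by rewrite addr0.
  by rewrite overlap1 // IHl 1?ltnW // intS addrA.
have [|x xE] := @path_of_letters e _ G (fun k => letter e (w k) 0).
  by move=> k; rewrite letter_path -(overlap (k) 0%N 1%N) // (leq_ltn_trans _ ms).
have xw k l : 0 <= l -> l <= s%:Z -> letter e x (k + l) = letter e (w k) l.
  move=> l0 ls; rewrite xE (_ : l = (absz l)%:Z); last by lia.
  by rewrite (overlap k 0%N) //; lia.
exists x; apply: (@letterP e) => k; rewrite -wE letter_pattern_path.
apply/pattern_atP => i j ir js; rewrite iter_dshift // letter_dshift.
have -> : letter e (iter i phi x) (j%:Z + k) =
    letter e (iter i phi (dshift e (m%:Z - (j%:Z + k)) (w (j%:Z + k - m%:Z)))) (j%:Z + k).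
  apply: mP => // l lm; rewrite letter_dshift -xw; try lia.
  by congr (letter _ _ _); lia.
rewrite iter_dshift // letter_dshift (_ : j%:Z + k + (m%:Z - (j%:Z + k)) = m%:Z); last by lia.
rewrite overlap //; last by lia.
by rewrite [RHS]overlap //; congr (letter _ (iter _ _ (w _)) _); lia.
Qed.

Lemma pattern_graph_nondegenerate r s : Defs.nondegenerate (pattern_graph e phi r s).
Proof.
have src_onto : onto (src e (pattern_graph e phi r s)).
  apply/ontoP => u; have [x <-] := patternP u.
  by exists (pattern_at e phi r s.+1 x); rewrite src_pattern.
have tgt_onto : onto (tgt e (pattern_graph e phi r s)).
  apply/ontoP => u; have [x <-] := patternP u.
  exists (pattern_at e phi r s.+1 (dshift e (-1) x)).
  by rewrite tgt_pattern // -dshiftD subrr dshift0.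
by move: src_onto tgt_onto; rewrite /src /tgt /Defs.nondegenerate; case: e.
Qed.

Variables (n m s : nat).
Hypotheses (ophi : onto phi) (nP : determination_bound e phi n)
  (mP : iterates_local n.+2 m) (ns : (n <= s)%N) (ms : (m.*2 < s)%N).

(** The existence half of right-resolving, for the homomorphism that forgets
    the first row. *)
Definition pattern_covering := forall (u : pattern e phi n.+2 s)
    (a : pattern e phi n.+1 s.+1),
  src e (pattern_graph e phi n.+1 s) a = subpattern n.+1 s 1 0 u ->
  exists b : pattern e phi n.+2 s.+1,
    subpattern n.+1 s.+1 1 0 b = a /\ src e (pattern_graph e phi n.+2 s) b = u.

(** Here [p] is a conjugacy and [phi] is onto, so every path of [Gamma] extends
    to a bi-infinite sequence as in the definition of the textile set, which is
    therefore the whole path shift. *)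
Lemma pattern_covering_essentially : pattern_covering -> essentially (q_resolving e) phi.
Proof.
move=> covers; pose P := pattern_graph e phi n.+1 s.
pose theta := pattern_path e ephi n.+1 s; pose lift := pattern_path e ephi n.+2 s.
have cjth : conjugacy theta.
  apply: bijective_conjugacy.
  - exact: pattern_path_continuous.
  - exact: pattern_path_equivariant.
  - exact: pattern_path_inj.
  - apply: (@pattern_path_onto n s m) => // i x y k ir; apply: mP; lia.
have [psi [epsi phi_psi]] := conj_transport cjth ephi.
exists (pattern e phi n.+1 s.+1), P, psi, theta.
split; first exact: pattern_graph_nondegenerate.
split=> //; first exact: (conj_onto cjth phi_psi ophi).
pose T : textile_system P := TextileSystem (pattern_hom e ephi false n.+1 s)
  (pattern_hom e ephi true n.+1 s).
have tpE x : hom_map (tp T) (lift x) = theta x := hom_map_pattern_path e ephi false _ _ _.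
have tqE x : hom_map (tq T) (lift x) = theta (phi x) := hom_map_pattern_path e ephi true _ _ _.
have lift_onto : forall z, exists x, lift x = z := pattern_path_onto mP ms.
have ZT z : textile_set T z.
  have [x <-] := lift_onto z; have [u ou u0] := onto_orbit x ophi.
  exists (fun i => lift (u i)); split; first by rewrite u0.
  by move=> i; rewrite tqE tpE ou subrK.
exists T; split; last split.
- apply/q_resolvingP => u a au; have [b [ba bu]] := covers u a au.
  exists b; split=> // b' [b'a b'u].
  apply: (pattern_hom_resolving (ephi := ephi) nP ns).
    by rewrite bu b'u.
  exact: etrans ba (esym b'a).
- apply/seteqP; split=> // y _.
  have [x <-] : exists x, theta x = y.
    by have [theta' [_ _ K]] := conjugacy_inverse cjth; exists (theta' y).
  by exists (lift x).
- move=> z z' _ _; have [x <-] := lift_onto z; have [y <-] := lift_onto z'.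
  by rewrite !tpE => /(conjugacy_inj cjth) ->.
- move=> y z _; have [x <-] := lift_onto z; rewrite tpE tqE => <-.
  by rewrite phi_psi.
Qed.

Lemma transitive_pattern_covering :
  topologically_transitive (path_shift G) -> pattern_covering.
Proof.
move=> trX u a au.
apply: (@onto_covering _ _ _ _ e (pattern_hom e ephi true n.+1 s)) => //.
- exact: pattern_hom_resolving.
- move=> y; have [x <-] : exists x, pattern_path e ephi n.+1 s x = y.
    apply: (@pattern_path_onto n s m) => // i x' y' k ir; apply: mP; lia.
  have [x' <-] := (ontoP phi).1 ophi x.
  exists (pattern_path e ephi n.+2 s x'); exact: hom_map_pattern_path.
- move=> {au} {}a; have [x <-] := patternP a.
  by exists (pattern_path e ephi n.+1 s x); rewrite letter_pattern_path dshift0.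
- move=> v v'; have [x xv] := patternP v; have [x' xv'] := patternP v'.
  have op w := locally_constant_open w (@locally_constant_pattern_at e _ _ phi ephi n.+2 s).
  have [||y [k [yv yv']]] := transitive_dshift e trX (op v) (op v').
  + by exists x.
  + by exists x'.
  exists (pattern_path e ephi n.+2 s y), k.
  by rewrite !letter_pattern_path !src_pattern // dshift0.
Qed.

(** Let the vertex occur in [x] and the arc in [y], so that [phi x] and [y]
    agree on the columns [0, ..., s - 1]. Their splice [y'] agrees with
    [phi x] to the left of column [s] and with [y] from column 0 on, and as the
    overlap is wider than twice the windows, so do all the rows concerned. Its
    preimage [x'] agrees with [x] far to the left because [phi] is invertible,
    and then up to column [s] by the determination of letters from the left,
    all rows but the first being known to agree. So [x'] shows the lift. *)
Lemma injective_pattern_covering : injective phi -> pattern_covering.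
Proof.
move=> phiI; have [l lP] := injective_local e ephi.1 phiS phiI.
move=> u a; have [x <-] := patternP u; have [y <-] := patternP a.
rewrite src_pattern // subpattern_row // => /pattern_atP yx.
have {}yx i j : (i <= n)%N -> 0 <= j -> j < s%:Z ->
    letter e (iter i phi y) j = letter e (iter i.+1 phi x) j.
  move=> ir j0 js; rewrite iterSr (_ : j = (absz j)%:Z); last by lia.
  by apply: yx; lia.
have [|y' [y'l y'r]] := @path_splice e _ G (phi x) y 0.
  by congr (src _ _ _); rewrite -(yx 0%N) //; lia.
have y'phix j : j < s%:Z -> letter e y' j = letter e (phi x) j.
  move=> js; have [j0|j0] := ltP j 0; first exact: y'l.
  by rewrite y'r // (yx 0%N).
have rows_left i j : (i <= n)%N -> j < s%:Z ->
    letter e (iter i phi y') j = letter e (iter i.+1 phi x) j.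
  move=> ir js; have [jm|jm] := ltP (j + m%:Z) s%:Z.
    by rewrite iterSr; apply: mP => [|t tm]; [lia|apply: y'phix; lia].
  rewrite -yx //; last by lia.
  by apply: mP => [|t tm]; [lia|apply: y'r; lia].
have rows_right i j : (i <= n)%N -> 0 <= j -> j <= s%:Z ->
    letter e (iter i phi y') j = letter e (iter i phi y) j.
  move=> ir j0 js; have [jlt|jge] := ltP j s%:Z; first by rewrite rows_left // yx.
  by apply: mP => [|t tm]; [lia|apply: y'r; lia].
have [x' x'y'] := (ontoP phi).1 ophi y'.
(* The agreement of the first rows propagates to the right, one column at a time. *)
have row0 t j : j < s%:Z - l%:Z + t%:Z -> j < s%:Z -> letter e x' j = letter e x j.
  elim: t j => [|t IHt] j jt js.
    by apply: lP => k kl; rewrite x'y' y'phix //; lia.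
  apply: nP => -[|i] j' i_n j'n; first by apply: IHt; lia.
  by rewrite iterSr x'y'; apply: rows_left; lia.
exists (pattern_at e phi n.+2 s.+1 x'); split.
  rewrite subpattern_row //; apply/pattern_atP => i j ir js.
  by rewrite [iter 1 phi x']x'y'; apply: rows_right; lia.
rewrite src_pattern //; apply/pattern_atP => -[|i] j ir js.
  by apply: (row0 l); lia.
by rewrite iterSr x'y'; apply: rows_left; lia.
Qed.

End MarkovShift.

Theorem pos_expansive_essentially e (A : finType) (X : subshift A) (phi : X -> X) :
  endomorphism phi -> onto phi -> SFT X ->
  injective phi \/ topologically_transitive X ->
  pos_expansive e phi -> essentially (q_resolving e) phi.
Proof.
move=> ephi ophi [B [G [theta [_ cth]]]] inj_or_tr pe.
have [psi [epsi phi_psi]] := conj_transport cth ephi.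
apply: (essentially_conj cth phi_psi).
have [theta' [cth' thK th'K]] := conjugacy_inverse cth.
have psi_phi y : theta' (psi y) = phi (theta' y) by rewrite -{1}(th'K y) -phi_psi thK.
have opsi := conj_onto cth phi_psi ophi.
have pepsi := conj_pos_expansive cth' psi_phi epsi.2 pe.
have [n nP] := pos_expansive_local epsi pepsi.
have [m mP] := iterates_localP e epsi n.+2.
pose s := (n + m.*2).+1.
apply: (@pattern_covering_essentially e B G psi epsi n m s) => //; try by rewrite /s; lia.
case: inj_or_tr => [phiI|trX].
  apply: (injective_pattern_covering epsi opsi nP mP); rewrite /s; try lia.
  exact: (conj_inj cth phi_psi phiI).
apply: (transitive_pattern_covering epsi opsi nP mP); rewrite /s; try lia.
exact: (conj_transitive cth trX).
Qed.

Theorem essentially_weakly_pos_expansive e (A : finType) (X : subshift A)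
    (phi : X -> X) :
  endomorphism phi -> onto phi -> essentially_weakly (weakly_q_resolving e) phi ->
  orbit_expansive e phi -> pos_expansive e phi.
Proof.
move=> ephi ophi [B [Y [psi [theta [_ [epsi wpsi cth phi_psi]]]]]].
exact: (conj_weakly_resolving_pos_expansive cth phi_psi).
Qed.

Theorem essentially_pos_expansive e (A : finType) (X : subshift A) (phi : X -> X) :
  endomorphism phi -> onto phi -> essentially (q_resolving e) phi ->
  orbit_expansive e phi -> pos_expansive e phi.
Proof.
move=> ephi ophi [B [G [psi [theta [_ [epsi _ rpsi cth phi_psi]]]]]].
apply: (conj_weakly_resolving_pos_expansive cth phi_psi) => //.
by apply: resolving_weakly_resolving rpsi => T; exact: q_resolving_weakly.
Qed.

Theorem theorem8p9 (R : realType) (A : finType) (X : subshift A)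
    (d : X -> X -> R) (phi : X -> X)
    (hA : (1 < #|A|)%N) (hd : compatible_metric d) (hphi : endomorphism phi) :
  (* (1) *)
  ((positively_left_expansive d phi -> essentially_weakly weakly_qR phi) /\
   (positively_right_expansive d phi -> essentially_weakly weakly_qL phi)) /\
  (* (2) *)
  (onto phi ->
    (essentially_weakly weakly_qR phi /\ left_expansive d phi <->
      positively_left_expansive d phi) /\
    (essentially_weakly weakly_qL phi /\ right_expansive d phi <->
      positively_right_expansive d phi)) /\
  (* (3) *)
  (SFT X -> (injective phi \/ topologically_transitive X) -> onto phi ->
    (essentially qR phi /\ left_expansive d phi <->
      positively_left_expansive d phi) /\
    (essentially qL phi /\ right_expansive d phi <->
      positively_right_expansive d phi)).
Proof.
rewrite (positively_left_expansiveE hd hphi) (positively_right_expansiveE hd hphi).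
rewrite (left_expansiveE hd hphi) (right_expansiveE hd hphi).
have weakly_of e : pos_expansive e phi -> essentially_weakly (weakly_q_resolving e) phi.
  exact: pos_expansive_essentially_weakly.
have weakly_iff e : onto phi ->
    essentially_weakly (weakly_q_resolving e) phi /\ orbit_expansive e phi <-> pos_expansive e phi.
  move=> ophi; split=> [[wphi oe]|pe]; first exact: essentially_weakly_pos_expansive oe.
  by split; [exact: weakly_of|exact: pos_expansive_orbit].
have iff e : SFT X -> injective phi \/ topologically_transitive X -> onto phi ->
    essentially (q_resolving e) phi /\ orbit_expansive e phi <-> pos_expansive e phi.
  move=> sftX inj_or_tr ophi; split=> [[rphi oe]|pe].
    exact: essentially_pos_expansive oe.
  by split; [exact: pos_expansive_essentially|exact: pos_expansive_orbit].
split; first by split; [exact: (weakly_of true)|exact: (weakly_of false)].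
split=> [ophi|sftX inj_or_tr ophi].
  by split; [exact: (weakly_iff true)|exact: (weakly_iff false)].
by split; [exact: (iff true)|exact: (iff false)].
Qed.
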